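(* Let $P$ be a finite poset whose cover graph has treewidth at most $2$. Then the dimension of $P$ is at most $12$.
   Context: The dimension of a finite poset $P$ is the least non-negative integer $d$ such that the partial order of $P$ is the intersection of $d$ linear orders on the ground set of $P$. For elements $x,y$ of $P$, $y$ covers $x$ if $x<y$ in $P$ and there is no element $z$ of $P$ with $x<z<y$ in $P$. The cover graph of $P$ is the simple graph whose vertex set is the ground set of $P$, in which two vertices are adjacent if and only if one of them covers the other in $P$. A tree-decomposition of a finite simple graph $G$ is a pair $(T,\{Y_u : u\in V(T)\})$, where $T$ is a tree and $\{Y_u : u \in V(T)\}$ is an indexed family of subsets of $V(G)$ (bags) such that: (T1) $V(G)=\bigcup_{u\in V(T)}Y_u$; (T2) for every edge $xy$ of $G$ there is a node $u$ of $T$ with $\{x,y\}\subseteq Y_u$; (T3) for all nodes $u_1,u_2,v$ of $T$, if $v$ lies on the path between $u_1$ and $u_2$ in $T$, then $Y_{u_1}\cap Y_{u_2}\subseteq Y_v$. Its width is $\max\{|Y_u|-1 : u\in V(T)\}$, and the treewidth of $G$ is the least width of a tree-decomposition of $G$. *)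

(* Defs.v *)
From mathcomp Require Import all_boot all_order all_algebra.
From mathcomp Require Import boolp zify.

Set Implicit Arguments.
Unset Strict Implicit.
Unset Printing Implicit Defensive.

Import Order.TTheory GRing.Theory Num.Theory.

Record sgraph := SGraph {
  vertex :> finType;
  adj : rel vertex;
  adj_sym : symmetric adj;
  adj_irr : irreflexive adj
}.

(* Acyclicity only forbids length 3 or more: [ucycle] also counts the empty
   sequence and a single edge walked back and forth as cycles. *)
Definition is_tree (T : sgraph) : Prop :=
  [/\ 0 < #|T|,
      forall u v : T, connect (@adj T) u v &
      forall c : seq T, ucycle (@adj T) c -> size c <= 2].

Record tree_decomposition (G T : sgraph) (Y : T -> {set G}) : Prop :=
  TreeDecomposition {
    td_tree : is_tree T;
    td_vertices : \bigcup_(u : T) Y u = [set: G];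
    td_edges : forall x y : G, adj x y ->
      exists u : T, [set x; y] \subset Y u;
    td_paths : forall (u1 u2 v : T) (p : seq T),
      path (@adj T) u1 p -> last u1 p = u2 -> uniq (u1 :: p) ->
      v \in u1 :: p -> Y u1 :&: Y u2 \subset Y v
  }.

(* The width of a family of empty bags is -1, hence the integers; the default
   value -1 is a lower bound of all the terms, and a tree has at least one
   node, so this is the genuine maximum. *)
Definition width (G T : sgraph) (Y : T -> {set G}) : int :=
  (\big[Order.max/-1]_(u : T) (#|Y u|%:Z - 1))%R.

Lemma td_exists (G : sgraph) :
  exists n : nat, `[< exists (T : sgraph) (Y : T -> {set G}),
    tree_decomposition Y /\ width Y = (n%:Z - 1)%R >].
Proof.
pose T := @SGraph unit (fun _ _ => false) (fun _ _ => erefl) (fun _ => erefl).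
pose Y := fun _ : T => [set: G].
exists #|G|; apply/asboolP; exists T, Y; split; last first.
- rewrite /width (bigD1 (tt : T)) //= big1_idem //=.
  by rewrite /Y cardsT; apply/max_idPl; lia.
- split.
  + split; first by rewrite card_unit.
      by move=> [] []; exact: connect0.
    by case=> [//|[] [//|[] [//|[] c]]] /andP[].
  + by rewrite (bigD1 (tt : T)) //= setTU.
  + by move=> x y _; exists tt; exact: subsetT.
  + by move=> u1 u2 v p _ _ _ _; exact: subsetT.
Qed.

(* A width is an integer at least -1, so the least width is obtained by
   minimising the natural number (width + 1). *)
Definition treewidth (G : sgraph) : int := ((ex_minn (td_exists G))%:Z - 1)%R.

Lemma width_ge (G T : sgraph) (Y : T -> {set G}) : (-1 <= width Y)%R.
Proof.
rewrite /width; elim/big_ind: _ => // [x y hx _|u _].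
  by rewrite le_max hx.
by lia.
Qed.

Lemma treewidth_attained (G : sgraph) :
  exists (T : sgraph) (Y : T -> {set G}),
    tree_decomposition Y /\ width Y = treewidth G.
Proof. by rewrite /treewidth; case: ex_minnP => n /asboolP. Qed.

Lemma treewidth_le (G T : sgraph) (Y : T -> {set G}) :
  tree_decomposition Y -> (treewidth G <= width Y)%R.
Proof.
move=> hY; rewrite /treewidth; case: ex_minnP => n _ hn.
have hw := width_ge Y.
have ew : ((absz (width Y + 1))%:Z = width Y + 1)%R by apply: gez0_abs; lia.
have : (n <= absz (width Y + 1)%R)%N.
  by apply: hn; apply/asboolP; exists T, Y; split=> //; rewrite ew addrK.
by lia.
Qed.

Section Poset.
Context {disp : Order.disp_t} (P : finPOrderType disp).
Local Open Scope order_scope.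

Definition covers (y x : P) : bool :=
  (x < y) && ~~ [exists z : P, (x < z) && (z < y)].

Definition cover_adj : rel P := fun x y => covers x y || covers y x.

Lemma cover_adj_sym : symmetric cover_adj.
Proof. by move=> x y; rewrite /cover_adj orbC. Qed.

Lemma cover_adj_irr : irreflexive cover_adj.
Proof. by move=> x; rewrite /cover_adj /covers ltxx. Qed.

Definition cover_graph : sgraph := SGraph cover_adj_sym cover_adj_irr.

Definition linear_order (r : rel P) : Prop :=
  [/\ reflexive r, antisymmetric r, transitive r & total r].

(* The intersection of zero linear orders is the full relation. *)
Definition realizer (d : nat) (L : 'I_d -> rel P) : Prop :=
  (forall i, linear_order (L i)) /\
  (forall x y : P, x <= y <-> forall i, L i x y).

Lemma realizer_exists :
  exists d : nat, `[< exists L : 'I_d -> rel P, realizer L >].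
Proof.
pose N := (#|P|.+1)%N.
pose k (x z : P) : nat :=
  ((((x <= z)%O * N) + #|[pred w : P | (w <= z)%O]|) * N + enum_rank z)%N.
have kN (z : P) : (enum_rank z < N)%N by exact: leq_trans (ltn_ord _) (leqnSn _).
have dN (z : P) : (#|[pred w : P | (w <= z)%O]| < N)%N by rewrite ltnS max_card.
have kinj (x : P) : injective (k x).
  move=> y z /(congr1 (modn^~ N)); rewrite !modnMDl !modn_small //.
  by move/val_inj/enum_rank_inj.
have kmono (x y z : P) : y < z -> (k x y < k x z)%N.
  move=> yz.
  have h1 : ((x <= y)%O <= (x <= z)%O)%N.
    by case: (boolP (x <= y)) => // xy; rewrite (le_trans xy (ltW yz)).
  have h2 : (#|[pred w : P | (w <= y)%O]| < #|[pred w : P | (w <= z)%O]|)%N.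
    apply: proper_card; apply/properP; split.
      by apply/subsetP => w; rewrite !inE => wy; exact: le_trans wy (ltW yz).
    by exists z; rewrite !inE ?lexx ?lt_geF.
  have := kN y; have := kN z; rewrite /k; nia.
exists #|P|; apply/asboolP.
exists (fun i y z => (k (enum_val i) y <= k (enum_val i) z)%N); split.
  move=> i; split.
  - by move=> y; exact: leqnn.
  - by move=> y z; rewrite -eqn_leq => /eqP/kinj.
  - by move=> y x z; exact: leq_trans.
  - by move=> y z; exact: leq_total.
move=> x y; split=> [|h].
  rewrite le_eqVlt => /predU1P[-> i|xy i]; first exact: leqnn.
  by apply: ltnW; exact: kmono.
apply: contraT => nxy; have := h (enum_rank x); rewrite enum_rankK /k.
rewrite lexx (negbTE nxy).
have := dN y; have := kN y; nia.
Qed.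

Definition dimension : nat := ex_minn realizer_exists.

Lemma dimension_attained : exists L : 'I_dimension -> rel P, realizer L.
Proof. by rewrite /dimension; case: ex_minnP => d /asboolP. Qed.

Lemma dimension_le (d : nat) (L : 'I_d -> rel P) :
  realizer L -> (dimension <= d)%N.
Proof.
move=> hL; rewrite /dimension; case: ex_minnP => m _; apply.
by apply/asboolP; exists L.
Qed.

End Poset.

(* Main.v *)
Require Import Defs.
From mathcomp Require Import all_boot all_order all_algebra.
From mathcomp Require Import boolp zify.

(* A graph of treewidth at most 2 is contained in a 2-tree, and a 2-tree is
   obtained from single edges by series and parallel compositions of pieces
   attached to the rest of the graph at two terminals.  By induction on such a
   construction, every piece has twelve linear extensions reversing all its
   incomparable pairs and placing its elements around the two terminals in
   prescribed ways, for instance every element not forced above a terminal goes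
   below both.  When two pieces are glued, their linear extensions are cut at the
   terminals into blocks that are interleaved.  An element of one piece compares
   with an element of the other only through the terminals, so that whether the
   interleavings reverse all new incomparable pairs depends only on how the two
   elements and the terminals compare: it is a finite verification, done by
   computation. *)

Set Implicit Arguments.
Unset Strict Implicit.
Unset Printing Implicit Defensive.

Import Order.TTheory.

(** * Finite case analysis *)

(* The trace of [z] with respect to terminals [u] and [v] is
   [(z <= u, z <= v, u <= z, v <= z)]. *)
Definition trace : Type := bool * bool * bool * bool.

Definition flip (t : trace) : trace :=
  let: (zu, zv, uz, vz) := t in (zv, zu, vz, uz).

(** The implications forced by transitivity; traces violating them never occur, and leaving them out
    makes the finite checks true. *)
Definition consistent (uv vu : bool) (t : trace) : bool :=
  let: (zu, zv, uz, vz) := t in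
  [&& zu && uv ==> zv, zv && vu ==> zu, uz && vu ==> vz, vz && uv ==> uz,
      uz && zv ==> uv & vz && zu ==> vu].

Definition bools := [:: true; false].

Definition pairs (A B : Type) (s : seq A) (t : seq B) := [seq (x, y) | x <- s, y <- t].

Definition traces (uv vu : bool) : seq trace :=
  [seq t <- pairs (pairs (pairs bools bools) bools) bools | consistent uv vu t].

Inductive kind := High | Low | Mid of bool & bool.

(* Blocks 0, 2, 4 are below, between and above the terminals placed at
   [pl < pu]; blocks 1 and 3 are the terminals themselves. *)
Definition block (pl pu p : nat) : nat := (pl <= p) + (pl < p) + (pu <= p) + (pu < p).

(* The boolean in [s] tells whether the first terminal is the lower one in the
   linear extension.  [High] pushes the terminals up, i.e. every element not
   forced above them goes below; [Low] is its dual.  [Mid x y] keeps elements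
   above the lower terminal only (if [x]) and elements below the upper terminal
   only (if [y]) between the terminals. *)
Definition fits (s : kind * bool) (t : trace) (k : nat) : bool :=
  let: (zl, zu, lz, uz) := if s.2 then t else flip t in
  [&& (k == 1) == zl && lz, (k == 3) == zu && uz,
      zl ==> (k <= 1), zu ==> (k <= 3), lz ==> (1 <= k), uz ==> (3 <= k) &
  match s.1 with
  | High => (uz || (k < 3)) && [|| uz, lz | k < 1]
  | Low => (zl || (1 < k)) && [|| zl, zu | 3 < k]
  | Mid x y => (x && lz && ~~ uz ==> (k < 3)) && (y && zu && ~~ zl ==> (1 < k))
  end].

Definition orient : Type := bool * bool * bool.

(* For incomparable terminals the orientation of some slots is arbitrary, but
   two pieces glued in parallel must agree on it: this is the parameter [o]. *)
Definition slots (uv vu : bool) (o : orient) : seq (kind * bool) :=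
  if uv || vu then
    [:: (High, uv); (Low, uv); (Mid true true, uv); (Mid true false, uv);
        (Mid false true, uv); (Mid false false, uv)]
  else
    [:: (High, o.1.1); (Low, o.1.2); (Mid true true, true); (Mid true true, false);
        (Mid true true, o.2); (Mid false false, o.2)].

Definition slot uv vu o i := nth (High, true) (slots uv vu o) i.

(* The order on the terminals [a], [b], [c] of a series composition, the first
   piece lying between [a] and [c] and the second one between [b] and [c]. *)
Definition rel3 : Type := (bool * bool) * ((bool * bool) * (bool * bool)).
Definition ab (r : rel3) := r.1.1.
Definition ba (r : rel3) := r.1.2.
Definition ac (r : rel3) := r.2.1.1.
Definition ca (r : rel3) := r.2.1.2.
Definition bc (r : rel3) := r.2.2.1.
Definition cb (r : rel3) := r.2.2.2.

(** Turns the trace with respect to [a] and [c] into the one with respect to [a] and [b]: an element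
    of the first piece compares with [b] only through [c] or through [a]. *)
Definition ext1 (r : rel3) (t : trace) : trace :=
  let: (za, zc, az, cz) := t in
  (za, za && ab r || zc && cb r, az, ba r && az || bc r && cz).

Definition ext2 (r : rel3) (t : trace) : trace :=
  let: (zb, zc, bz, cz) := t in
  (zb && ba r || zc && ca r, zb, ab r && bz || ac r && cz, bz).

(** A comparability from the first piece to the second passes through the shared terminal [c] or
    through a relation between [a] and [b]. *)
Definition le12 (r : rel3) (t1 t2 : trace) : bool :=
  let: (xa, xc, ax, cx) := t1 in let: (yb, yc, b_y, cy) := t2 in
  xc && cy || [&& xa, ab r & b_y].

Definition le21 (r : rel3) (t1 t2 : trace) : bool :=
  let: (xa, xc, ax, cx) := t1 in let: (yb, yc, b_y, cy) := t2 in
  yc && cx || [&& yb, ba r & ax].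

Definition terminal (o : bool) := if o then 1 else 3.
Definition blocks := [:: 0; 1; 2; 3; 4].

(* The terminals [a], [b], [c] sit at the positions 3, 6, 9 in the chosen order,
   and each block is put in one of the gaps between them.  The only freedom is
   on which side of [b] goes the block of the first piece that could contain
   [b], on which side of [a] goes the block of the second piece that could
   contain [a], and (through [f]) which piece comes first within a gap. *)
Definition weave (f : bool) (s : kind * bool) (o1 o2 : bool) : seq nat * seq nat :=
  let o := s.2 in
  let pa := 3 * (1 + ~~ o + ~~ o1) in
  let pb := 3 * (1 + o + ~~ o2) in
  let pc := 3 * (1 + o1 + o2) in
  let before := match s.1 with
    | High => (true, true)
    | Low => (false, false)
    | Mid x y => if o then (x || f, ~~ (y || f)) else (~~ y && f, x || ~~ f)
    end in
  let gap p (b : bool) l := if (l + 3 == p) && ~~ b then l + 3 else l in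
  let code p b e l u := [:: gap p b 0 + e; l; gap p b l + e; u; gap p b u + e] in
  (code pb before.1 (if f then 1 else 2) (if o1 then pa else pc) (if o1 then pc else pa),
   code pa before.2 (if f then 2 else 1) (if o2 then pb else pc) (if o2 then pc else pb)).

(** The pieces keep their internal order, their positions coincide only at [c], and whatever fits
    the slots of the pieces fits the slot of the composition after weaving. *)
Definition good_weave (r : rel3) (s s1 s2 : kind * bool) (w : seq nat * seq nat) : bool :=
  let pa := nth 0 w.1 (terminal s1.2) in
  let pb := nth 0 w.2 (terminal s2.2) in
  let pl := if s.2 then pa else pb in
  let pu := if s.2 then pb else pa in
  let good s' c ext := all (fun t => all (fun k =>
      fits s' t k ==> fits s (ext t) (block pl pu (nth 0 c k))) blocks) in
  [&& [&& size w.1 == 5, sorted ltn w.1, size w.2 == 5, sorted ltn w.2 & pl < pu],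
      all (fun k1 => all (fun k2 => (nth 0 w.1 k1 == nth 0 w.2 k2) ==
        (k1 == terminal (~~ s1.2)) && (k2 == terminal (~~ s2.2))) blocks) blocks,
      good s1 w.1 (ext1 r) (traces (ac r) (ca r)) &
      good s2 w.2 (ext2 r) (traces (bc r) (cb r))].

(** Quantifying over all admissible blocks makes the conclusion independent of the linear extensions
    chosen for the pieces. *)
Definition precedes (c1 c2 : seq nat) (s1 s2 : kind * bool) (t1 t2 : trace) : bool :=
  all (fun k1 => fits s1 t1 k1 ==>
    all (fun k2 => fits s2 t2 k2 ==> (nth 0 c1 k1 < nth 0 c2 k2)) blocks) blocks.

(* [c] goes as low as possible in the [High] slot, as high as possible in the
   [Low] slot, and between [a] and [b] if possible in the remaining slots. *)
Definition child_orients (r : rel3) (o : orient) : orient * orient :=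
  let: (o1, o2, o3) := o in
  ((ac r || [&& ~~ ca r, o1 & bc r],
    ~~ (ca r || [&& ~~ ac r, ~~ o2 & cb r]),
    if o3 then ~~ ca r else ac r),
   (bc r || [&& ~~ cb r, ~~ o1 & ac r],
    ~~ (cb r || [&& ~~ bc r, o2 & ca r]),
    if o3 then bc r else ~~ cb r)).

(* Which slots of the two pieces are woven into a given slot; these four choices
   were found by computer search. *)
Definition perms : seq (seq nat * seq nat) :=
  pairs [:: [:: 0; 1; 2; 3; 4; 5]; [:: 0; 1; 3; 4; 2; 5]]
        [:: [:: 0; 1; 4; 3; 2; 5]; [:: 0; 1; 3; 2; 4; 5]].

(** The first two alternatives on traces discard elements equal to [c]; the last one treats both
    directions of a cross pair. *)
Definition series_ok (r : rel3) (o : orient) (p : seq nat * seq nat) : bool :=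
  let q := child_orients r o in
  let S i := slot (ab r) (ba r) o i in
  let S1 i := slot (ac r) (ca r) q.1 (nth 0 p.1 i) in
  let S2 i := slot (bc r) (cb r) q.2 (nth 0 p.2 i) in
  let W d := weave d.2 (S d.1) (S1 d.1).2 (S2 d.1).2 in
  let D := pairs (iota 0 6) bools in
  all (fun d => good_weave r (S d.1) (S1 d.1) (S2 d.1) (W d)) D &&
  all (fun t1 => all (fun t2 =>
    [|| t1.1.1.2 && t1.2, t2.1.1.2 && t2.2 |
     (le12 r t1 t2 || has (fun d => precedes (W d).2 (W d).1 (S2 d.1) (S1 d.1) t2 t1) D) &&
     (le21 r t1 t2 || has (fun d => precedes (W d).1 (W d).2 (S1 d.1) (S2 d.1) t1 t2) D)])
    (traces (bc r) (cb r))) (traces (ac r) (ca r)).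

Definition consistent3 (r : rel3) : bool :=
  [&& ~~ (ab r && ba r), ~~ (ac r && ca r), ~~ (bc r && cb r),
   ab r && bc r ==> ac r, ac r && cb r ==> ab r,
   ba r && ac r ==> bc r, bc r && ca r ==> ba r,
   ca r && ab r ==> cb r & cb r && ba r ==> ca r].

Definition rels : seq rel3 :=
  let bb := pairs bools bools in [seq r <- pairs bb (pairs bb bb) | consistent3 r].

(** For comparable terminals [slots] does not depend on the orientation, so one representative
    suffices. *)
Definition orients (uv vu : bool) : seq orient :=
  if uv || vu then [:: (uv, uv, uv)] else pairs (pairs bools bools) bools.

(** Equal blocks are accepted because the tie between the pieces can be broken either way. One
    direction is enough, as the traces range over all ordered pairs. *)
Definition parallel_ok (uv vu : bool) (o : orient) : bool :=
  let S i := slot uv vu o i in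
  all (fun t1 : trace => all (fun t2 : trace =>
    let: (xu, xv, ux, vx) := t1 in let: (yu, yv, uy, vy) := t2 in
    [|| xu && ux, xv && vx, yu && uy, yv && vy, xu && uy, xv && vy |
     has (fun i => all (fun k1 => fits (S i) t1 k1 ==>
       all (fun k2 => fits (S i) t2 k2 ==> (k2 <= k1)) blocks) blocks) (iota 0 6)])
    (traces uv vu)) (traces uv vu).

(* [lazy] short-circuits the boolean connectives, [vm_compute] does not. *)
Lemma series_check :
  all (fun r => all (fun o => has (series_ok r o) perms) (orients (ab r) (ba r))) rels.
Proof. by lazy. Qed.

Lemma parallel_check :
  all (fun c => c.1 && c.2 || all (parallel_ok c.1 c.2) (orients c.1 c.2)) (pairs bools bools).
Proof. by lazy. Qed.

(** * Properties of blocks, traces and slots *)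

Lemma block_le4 pl pu p : block pl pu p <= 4.
Proof. rewrite /block; lia. Qed.

Lemma leq_block pl pu p p' : p <= p' -> block pl pu p <= block pl pu p'.
Proof. rewrite /block; lia. Qed.

Lemma block_lower pl pu : pl < pu -> block pl pu pl = 1.
Proof. rewrite /block; lia. Qed.

Lemma block_upper pl pu : pl < pu -> block pl pu pu = 3.
Proof. rewrite /block; lia. Qed.

Lemma mem_blocks k : (k \in blocks) = (k <= 4).
Proof. by do 5?[case: k => [|k] //]. Qed.

Lemma mem_traces uv vu t : (t \in traces uv vu) = consistent uv vu t.
Proof. by rewrite mem_filter; case: t => [[[[] []] []] []]; rewrite andbT. Qed.

Lemma mem_orients uv vu o :
  exists2 o', o' \in orients uv vu & forall i, slot uv vu o i = slot uv vu o' i.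
Proof.
rewrite /orients /slot /slots; case: (uv || vu); first by exists (uv, uv, uv); rewrite ?inE.
by exists o => //; case: o => [[[] []] []].
Qed.

Lemma slot_orient uv vu o i : i < 6 -> uv != vu -> (slot uv vu o i).2 = uv.
Proof. by rewrite /slot /slots; case: uv vu => -[] //=; do 6?[case: i => [|i] //]. Qed.

Lemma mem_rels r : (r \in rels) = consistent3 r.
Proof. by rewrite mem_filter; case: r => [[[] []] [[[] []] [[] []]]]; rewrite andbT. Qed.

(** Every slot of either piece is woven into some slot, so a pair reversed inside a piece stays
    reversed after gluing. *)
Lemma perms_onto p i : p \in perms -> i < 6 ->
  exists j1 j2, [/\ j1 < 6, j2 < 6, nth 0 p.1 j1 = i & nth 0 p.2 j2 = i].
Proof.
move=> pP iP.
have /allP/(_ p pP)/allP/(_ i) : all (fun p : seq nat * seq nat => all (fun i =>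
  (i \in p.1) && (i \in p.2) && (size p.1 == 6) && (size p.2 == 6)) (iota 0 6)) perms by [].
rewrite mem_iota => /(_ iP) /andP[/andP[/andP[i1 i2] /eqP s1] /eqP s2].
exists (index i p.1), (index i p.2).
by split; rewrite ?nth_index //; [rewrite -[6]s1 | rewrite -[6]s2]; rewrite index_mem.
Qed.

Lemma perms_bound p i : p \in perms -> i < 6 -> nth 0 p.1 i < 6 /\ nth 0 p.2 i < 6.
Proof.
move=> pP iP; apply/andP.
have /allP/(_ p pP)/allP/(_ i) : all (fun p : seq nat * seq nat => all (fun i =>
  (nth 0 p.1 i < 6) && (nth 0 p.2 i < 6)) (iota 0 6)) perms by [].
by rewrite mem_iota => /(_ iP).
Qed.

(** * Gluing families of linear extensions *)

Section Extensions.
Context {disp : Order.disp_t} {P : finPOrderType disp}.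
Local Open Scope order_scope.
Implicit Types (a b c u v x y z : P) (S : {set P}) (f p q : P -> nat).

Definition trace_of u v z : trace := (z <= u, z <= v, u <= z, v <= z).

Lemma trace_of_traces u v z : trace_of u v z \in traces (u <= v) (v <= u).
Proof.
rewrite mem_traces /trace_of /consistent.
by do !(apply/andP; split); apply/implyP => /andP[h1 h2];
  apply: le_trans h1 h2 || apply: le_trans h2 h1.
Qed.

Definition mono_on S f := {in S &, forall x y, (x < y) -> (f x < f y)%N}.

Definition lower u v (s : kind * bool) := if s.2 then u else v.
Definition upper u v (s : kind * bool) := if s.2 then v else u.

Definition pos u v s f z := block (f (lower u v s)) (f (upper u v s)) (f z).

Definition fitting S u v s f :=
  (f (lower u v s) < f (upper u v s))%N /\ {in S, forall z, fits s (trace_of u v z) (pos u v s f z)}.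

(* Each of the six slots is used twice: the boolean [d] decides which of two
   pieces comes first when they compete for a block. *)
Definition ext_family S u v (o : orient) (F : nat -> bool -> P -> nat) :=
  (forall i d, (i < 6)%N ->
     [/\ mono_on S (F i d), {in S &, injective (F i d)} &
         fitting S u v (slot (u <= v) (v <= u) o i) (F i d)]) /\
  {in S &, forall x y, ~~ (x <= y) -> exists i d, (i < 6)%N /\ (F i d y < F i d x)%N}.

Definition extendable u v S := forall o, exists F, ext_family S u v o F.

(** * Lexicographic merging of two orders *)

Lemma lexi_ltn N k k' m m' : (m < N)%N -> (m' < N)%N ->
  (k * N + m < k' * N + m')%N = (k < k')%N || (k == k') && (m < m')%N.
Proof. by move=> mN mN'; case: (ltngtP k k') => [h|h|->] /=; nia. Qed.

Definition glue S p q z := if z \in S then p z else q z.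

(* Elements are ordered by position first; [e] breaks ties between the pieces. *)
Lemma merge S1 S2 f1 f2 p1 p2 (e : bool) :
  {in S1 &, forall x y, (f1 x <= f1 y)%N -> (p1 x <= p1 y)%N} ->
  {in S2 &, forall x y, (f2 x <= f2 y)%N -> (p2 x <= p2 y)%N} ->
  {in S1 :&: S2, p1 =1 p2} ->
  {in S1 & S1 :&: S2, forall x z, p1 x = p1 z -> x = z} ->
  {in S2 & S1 :&: S2, forall x z, p2 x = p2 z -> x = z} ->
  exists f,
  [/\ {in S1 &, forall x y, (f x < f y) = (f1 x < f1 y)}%N,
      {in S2 &, forall x y, (f x < f y) = (f2 x < f2 y)}%N,
      {in S1 :|: S2 &, forall x y,
         (glue S1 p1 p2 x < glue S1 p1 p2 y)%N -> (f x < f y)%N} &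
      {in S1 :\: S2 & S2 :\: S1, forall x y, glue S1 p1 p2 x = glue S1 p1 p2 y ->
         if e then (f x < f y)%N else (f y < f x)%N}].
Proof.
move=> m1 m2 p12 u1 u2.
pose N := (\max_z f1 z + \max_z f2 z).+1.
have N1 z : (f1 z < N)%N by rewrite /N ltnS; apply: leq_trans (leq_addr _ _); apply: leq_bigmax.
have N2 z : (f2 z < N)%N by rewrite /N ltnS; apply: leq_trans (leq_addl _ _); apply: leq_bigmax.
pose g z := if z \in S1 then f1 z else f2 z.
have Ng z : (g z < N)%N by rewrite /g; case: ifP.
pose q := glue S1 p1 p2.
(* Doubling the position leaves room for the bit that breaks ties; shared elements count as elements
   of [S1]. *)
pose k z := (q z * 2 + (if z \in S1 then ~~ e else e))%N.
exists (fun z => (k z * N + g z)%N) => /=; rewrite -/q.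
have q2 z : z \in S2 -> q z = p2 z.
  by move=> zS; rewrite /q /glue; case: ifP => // zS1; apply: p12; rewrite inE zS1.
split.
- move=> x y xS yS; rewrite lexi_ltn // /k /g /q /glue xS yS.
  have := m1 _ _ xS yS; have := m1 _ _ yS xS.
  by case: (ltngtP (f1 x) (f1 y)) => h; case: (e); lia.
(* Shared elements carry values of [f1], yet the order of [f2] survives because no other element of
   [S2] has their position. *)
- move=> x y xS yS; rewrite lexi_ltn // /k /g !q2 //.
  have := m2 _ _ xS yS; have := m2 _ _ yS xS.
  have [<-|xy] := eqVneq x y; first by move=> _ _; rewrite !ltnn eqxx andbF.
  have h1 : y \in S1 -> p2 x <> p2 y.
    by move=> yS1 /u2 e1; move: xy; rewrite e1 ?eqxx // inE yS1.
  have h2 : x \in S1 -> p2 x <> p2 y.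
    by move=> xS1 /esym/u2 e1; move: xy; rewrite e1 ?eqxx // inE xS1.
  move: h1 h2; case: (x \in S1); case: (y \in S1) => h1 h2 h3 h4;
    case: (ltngtP (f2 x) (f2 y)) => h5; case: (e); try have := h1 erefl; try have := h2 erefl; lia.
- move=> x y _ _ h; rewrite lexi_ltn // /k; apply/orP; left.
  by case: (x \in S1); case: (y \in S1); case: (e); lia.
- move=> x y /setDP[xS1 xS2] /setDP[yS2 yS1] h.
  have kx : k x = (q x * 2 + ~~ e)%N by rewrite /k xS1.
  have ky : k y = (q y * 2 + e)%N by rewrite /k (negbTE yS1).
  rewrite (lexi_ltn _ _ (Ng x) (Ng y)) (lexi_ltn _ _ (Ng y) (Ng x)) kx ky h.
  by case: (e); apply/orP; left; rewrite /=; lia.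
Qed.

Definition sep (e : {set P}) x y := x <= y -> exists2 w, w \in e & x <= w <= y.

Lemma in_setU_cross S1 S2 (R : P -> P -> Prop) :
  {in S1 &, forall x y, R x y} -> {in S2 &, forall x y, R x y} ->
  {in S1 :\: S2 & S2 :\: S1, forall x y, R x y /\ R y x} ->
  {in S1 :|: S2 &, forall x y, R x y}.
Proof.
move=> h1 h2 h3 x y; rewrite !inE => xS yS.
have [xS1|xS1] := boolP (x \in S1); have [yS1|yS1] := boolP (y \in S1); first exact: h1.
- have [xS2|xS2] := boolP (x \in S2); first by move: yS; rewrite (negbTE yS1); apply: h2.
  have := h3 x y; rewrite !inE xS1 xS2 (negbTE yS1) /= in yS *.
  by move=> /(_ isT yS)[].
- have [yS2|yS2] := boolP (y \in S2); first by move: xS; rewrite (negbTE xS1) => xS; apply: h2.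
  have := h3 y x; rewrite !inE yS1 yS2 (negbTE xS1) /= in xS *.
  by move=> /(_ isT xS)[].
- by move: xS yS; rewrite (negbTE xS1) (negbTE yS1); apply: h2.
Qed.

Lemma fits_lower u v s z : fits s (trace_of u v z) 1 -> z = lower u v s.
Proof.
by case: s => [kd []] /andP[/eqP/esym/andP[h1 h2] _]; apply/eqP; rewrite eq_le h1 h2.
Qed.

Lemma fits_upper u v s z : fits s (trace_of u v z) 3 -> z = upper u v s.
Proof.
by case: s => [kd []] /andP[_ /andP[/eqP/esym/andP[h1 h2] _]]; apply/eqP; rewrite eq_le h1 h2.
Qed.

Lemma fitting_terminal S u v s f z (o : bool) : fitting S u v s f ->
  z \in S -> pos u v s f z = terminal o -> z = if o then lower u v s else upper u v s.
Proof.
by move=> [_ h] zS e; case: o e (h z zS) => /= -> h1; [apply: fits_lower h1 | apply: fits_upper h1].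
Qed.

Lemma pos_lower S u v s f : fitting S u v s f -> pos u v s f (lower u v s) = 1.
Proof. by move=> [h _]; apply: block_lower. Qed.

Lemma pos_upper S u v s f : fitting S u v s f -> pos u v s f (upper u v s) = 3.
Proof. by move=> [h _]; apply: block_upper. Qed.

(** If [f] refines the coarse positions [q] and each terminal is alone at its position, then
    comparisons with the terminals can be read off from [q]. *)
Lemma block_transfer S f q l u :
  {in S &, forall x y, (q x < q y)%N -> (f x < f y)%N} ->
  l \in S -> u \in S ->
  {in S, forall z, q z = q l -> z = l} -> {in S, forall z, q z = q u -> z = u} ->
  {in S, forall z, block (f l) (f u) (f z) = block (q l) (q u) (q z)}.
Proof.
move=> h lS uS hl hu z zS.
have key t : t \in S -> {in S, forall z, q z = q t -> z = t} ->
    ((f t <= f z) = (q t <= q z))%N /\ ((f t < f z) = (q t < q z))%N.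
  move=> tS ht; have := h _ _ tS zS; have := h _ _ zS tS.
  have [e|] := eqVneq z t; first by rewrite e; lia.
  by move=> zt; have : q z <> q t by [move=> /ht e; move: zt; rewrite e ?eqxx]; lia.
by have [h1 h2] := key l lS hl; have [h3 h4] := key u uS hu; rewrite /block h1 h2 h3 h4.
Qed.

Lemma ext_setU S1 S2 f1 f2 f :
  {in S1 &, forall x y, (f x < f y) = (f1 x < f1 y)}%N ->
  {in S2 &, forall x y, (f x < f y) = (f2 x < f2 y)}%N ->
  mono_on S1 f1 -> mono_on S2 f2 -> {in S1 &, injective f1} -> {in S2 &, injective f2} ->
  {in S1 :\: S2 & S2 :\: S1, forall x y,
     [/\ f x <> f y, x < y -> (f x < f y)%N & y < x -> (f y < f x)%N]} ->
  mono_on (S1 :|: S2) f /\ {in S1 :|: S2 &, injective f}.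
Proof.
move=> e1 e2 m1 m2 i1 i2 h; split.
  apply: in_setU_cross => [x y xS yS|x y xS yS|x y xS yS].
  - by rewrite e1 //; apply: m1.
  - by rewrite e2 //; apply: m2.
  - by have [_ ? ?] := h x y xS yS.
apply: in_setU_cross => [x y xS yS|x y xS yS|x y xS yS] => [e|e|].
- by apply: i1 => //; have := e1 _ _ xS yS; have := e1 _ _ yS xS; rewrite e !ltnn; lia.
- by apply: i2 => //; have := e2 _ _ xS yS; have := e2 _ _ yS xS; rewrite e !ltnn; lia.
- by have [ne _ _] := h x y xS yS; split=> e; case: ne.
Qed.

Lemma ext_family_cross S1 S2 u v o F :
  (forall i d, (i < 6)%N ->
     [/\ mono_on (S1 :|: S2) (F i d), {in S1 :|: S2 &, injective (F i d)} &
         fitting (S1 :|: S2) u v (slot (u <= v) (v <= u) o i) (F i d)]) ->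
  {in S1 &, forall x y, ~~ (x <= y) -> exists i d, (i < 6)%N /\ (F i d y < F i d x)%N} ->
  {in S2 &, forall x y, ~~ (x <= y) -> exists i d, (i < 6)%N /\ (F i d y < F i d x)%N} ->
  {in S1 :\: S2 & S2 :\: S1, forall x y,
     (~~ (x <= y) -> exists i d, (i < 6)%N /\ (F i d y < F i d x)%N) /\
     (~~ (y <= x) -> exists i d, (i < 6)%N /\ (F i d x < F i d y)%N)} ->
  ext_family (S1 :|: S2) u v o F.
Proof.
by move=> hF h1 h2 h3; split=> // ; apply: in_setU_cross => // x y xS yS; apply: h3.
Qed.

Lemma slots_choice (G : nat -> bool -> (P -> nat) -> Prop) :
  (forall i d, (i < 6)%N -> exists f, G i d f) ->
  exists F, forall i d, (i < 6)%N -> G i d (F i d).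
Proof.
move=> h; have h' (id : nat * bool) : exists f, (id.1 < 6)%N -> G id.1 id.2 f.
  have [/h i6|ni] := boolP (id.1 < 6)%N; last by exists (fun=> 0%N).
  by have [f hf] := i6 id.2; exists f.
have [F hF] := choice h'.
by exists (fun i d => F (i, d)) => i d i6; apply: (hF (i, d)).
Qed.

Lemma extendable_slots u v S o o' :
  (forall i, slot (u <= v) (v <= u) o i = slot (u <= v) (v <= u) o' i) ->
  (exists F, ext_family S u v o' F) -> exists F, ext_family S u v o F.
Proof.
move=> e [F [h1 h2]]; exists F; split=> // i d i6.
by rewrite e; apply: h1.
Qed.

(** * Parallel composition *)

Lemma parallel_slot u v o x y :
  u != v -> o \in orients (u <= v) (v <= u) ->
  x \notin [set u; v] -> y \notin [set u; v] -> ~~ (x <= y) ->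
  exists2 i, (i < 6)%N & forall k1 k2, (k1 <= 4)%N -> (k2 <= 4)%N ->
    fits (slot (u <= v) (v <= u) o i) (trace_of u v x) k1 ->
    fits (slot (u <= v) (v <= u) o i) (trace_of u v y) k2 -> (k2 <= k1)%N.
Proof.
move=> uv oP; rewrite !inE !negb_or => /andP[xu xv] /andP[yu yv] nxy.
have /allP/(_ (u <= v, v <= u)) := parallel_check.
have -> : (u <= v, v <= u) \in pairs bools bools by case: (u <= v) (v <= u) => -[].
move=> /(_ isT); rewrite ![fst _]/= ![snd _]/= => /orP[|/allP/(_ o oP)].
  by rewrite -eq_le (negbTE uv).
move=> /allP/(_ _ (trace_of_traces u v x))/allP/(_ _ (trace_of_traces u v y)).
rewrite /trace_of; cbv beta iota zeta.
rewrite -!eq_le (negbTE xu) (negbTE xv) (negbTE yu) (negbTE yv).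
have nle w : (x <= w) && (w <= y) = false.
  by apply/negP => /andP[h1 h2]; move: nxy; rewrite (le_trans h1 h2).
rewrite !nle !orFb => /hasP[i]; rewrite mem_iota => iP /allP h.
exists i => // k1 k2; rewrite -!mem_blocks => k1P k2P f1 f2.
by have /implyP/(_ f1)/allP/(_ _ k2P)/implyP/(_ f2) := h _ k1P.
Qed.

(** Each slot merges the two orders block by block, [d] deciding which piece comes first within a
    block. The result is a linear extension because comparabilities between the pieces pass through
    a terminal, where the two orders agree. *)
Lemma extendable_parallel u v S1 S2 :
  u != v -> S1 :&: S2 = [set u; v] ->
  {in S1 & S2, forall x y, sep [set u; v] x y /\ sep [set u; v] y x} ->
  extendable u v S1 -> extendable u v S2 -> extendable u v (S1 :|: S2).
Proof.
move=> uv S12 hsep E1 E2 o.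
have [o' o'P eo] := mem_orients (u <= v) (v <= u) o.
apply: extendable_slots eo _; have [F1 [h1 r1]] := E1 o'; have [F2 [h2 r2]] := E2 o'.
have [uS1 uS2] : u \in S1 /\ u \in S2 by apply/andP; rewrite -in_setI S12 !inE eqxx.
have [vS1 vS2] : v \in S1 /\ v \in S2 by apply/andP; rewrite -in_setI S12 !inE eqxx orbT.
pose s i := slot (u <= v) (v <= u) o' i.
pose G i d f :=
  [/\ {in S1 &, forall x y, (f x < f y) = (F1 i d x < F1 i d y)}%N,
      {in S2 &, forall x y, (f x < f y) = (F2 i d x < F2 i d y)}%N,
      [/\ mono_on (S1 :|: S2) f, {in S1 :|: S2 &, injective f} & fitting (S1 :|: S2) u v (s i) f] &
      {in S1 :\: S2 & S2 :\: S1, forall x y,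
        ((pos u v (s i) (F1 i d) x <= pos u v (s i) (F2 i d) y)%N -> d -> (f x < f y)%N) /\
        ((pos u v (s i) (F2 i d) y <= pos u v (s i) (F1 i d) x)%N -> ~~ d -> (f y < f x)%N)}].
have [F hF] : exists F, forall i d, (i < 6)%N -> G i d (F i d).
  apply: slots_choice => i d i6; have [m1 i1 f1] := h1 i d i6; have [m2 i2 f2] := h2 i d i6.
  have p1l := pos_lower f1; have p1u := pos_upper f1; have p2l := pos_lower f2; have p2u := pos_upper f2.
  rewrite -/(s i) in f1 f2 p1l p1u p2l p2u.
  have termE : [set u; v] = [set lower u v (s i); upper u v (s i)].
    by rewrite /lower /upper; case: ifP => // _; rewrite setUC.
  have pE z : z \in S1 :&: S2 -> exists t, [/\ pos u v (s i) (F1 i d) z = terminal t,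
      pos u v (s i) (F2 i d) z = terminal t & z = if t then lower u v (s i) else upper u v (s i)].
    by rewrite S12 termE => /set2P[->|->]; [exists true|exists false].
  have [||z zP|x z xS zP|x z xS zP|f /=] := merge (S1 := S1) (S2 := S2) (f1 := F1 i d) (f2 := F2 i d)
    (p1 := pos u v (s i) (F1 i d)) (p2 := pos u v (s i) (F2 i d)) d.
  - by move=> x y _ _; apply: leq_block.
  - by move=> x y _ _; apply: leq_block.
  - by have [t [-> -> _]] := pE z zP.
  - by have [t [-> _ ->]] := pE z zP; apply: fitting_terminal f1 xS.
  - by have [t [_ -> ->]] := pE z zP; apply: fitting_terminal f2 xS.
  set q := glue _ _ _ => -[M1 M2 M3 M4]; exists f.
  have q1 z : z \in S1 -> q z = pos u v (s i) (F1 i d) z by rewrite /q /glue => ->.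
  have q2 z : z \in S2 -> q z = pos u v (s i) (F2 i d) z.
    move=> zS2; rewrite /q /glue; case: ifP => // zS1.
    by have [|t [-> -> _]] := pE z; rewrite ?inE ?zS1.
  have lS : lower u v (s i) \in S1 :&: S2 by rewrite S12 termE set21.
  have uS : upper u v (s i) \in S1 :&: S2 by rewrite S12 termE set22.
  have [[lS1 lS2] [uuS1 uuS2]] := (setIP lS, setIP uS).
  have ql : q (lower u v (s i)) = 1 by rewrite q1.
  have qu : q (upper u v (s i)) = 3 by rewrite q1.
  have iso (t : bool) : {in S1 :|: S2, forall z, q z = terminal t -> z = if t then lower u v (s i) else upper u v (s i)}.
    by move=> z /setUP[zS|zS]; [rewrite q1 //; apply: fitting_terminal f1 zS|rewrite q2 //; apply: fitting_terminal f2 zS].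
  have M5 x y : x \in S1 :\: S2 -> y \in S2 :\: S1 ->
      [/\ f x <> f y, x < y -> (f x < f y)%N & y < x -> (f y < f x)%N].
    move=> xS yS; have [/setDP[xS1 xS2] /setDP[yS2 yS1]] := (xS, yS).
    have [s1 s2] := hsep x y xS1 yS2; split.
    - have := M4 x y xS yS; have := M3 x y; have := M3 y x; rewrite !inE xS1 yS2 !orbT /=.
      move=> a1 a2 a3 e; move: a1 a2 a3; rewrite e ltnn.
      by case: ltngtP => // [_ a _ _|_ _ a _|qe _ _ a]; [have := a isT isT isT|have := a isT isT isT|have := a (esym qe); case: (d)].
    - move=> /ltW/s1[w wS /andP[xw wy]]; move: wS; rewrite -S12 => /setIP[wS1 wS2].
      apply: (@ltn_trans (f w)); [rewrite M1 // m1 //|rewrite M2 // m2 //]; rewrite lt_neqAle ?xw ?wy andbT.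
        by apply: contraNneq xS2 => ->.
      by apply: contraNneq yS1 => <-.
    - move=> /ltW/s2[w wS /andP[yw wx]]; move: wS; rewrite -S12 => /setIP[wS1 wS2].
      apply: (@ltn_trans (f w)); [rewrite M2 // m2 //|rewrite M1 // m1 //]; rewrite lt_neqAle ?yw ?wx andbT.
        by apply: contraNneq yS1 => ->.
      by apply: contraNneq xS2 => <-.
  have [mf jf] := ext_setU M1 M2 m1 m2 i1 i2 M5.
  split=> //.
    split=> //; split; first by rewrite M1 //; case: f1.
    have lSU : lower u v (s i) \in S1 :|: S2 by rewrite inE lS1.
    have uSU : upper u v (s i) \in S1 :|: S2 by rewrite inE uuS1.
    have hl : {in S1 :|: S2, forall z, q z = q (lower u v (s i)) -> z = lower u v (s i)}.
      by move=> z zS; rewrite ql => /(iso true z zS).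
    have hu : {in S1 :|: S2, forall z, q z = q (upper u v (s i)) -> z = upper u v (s i)}.
      by move=> z zS; rewrite qu => /(iso false z zS).
    move=> z zS; rewrite /pos (block_transfer M3 lSU uSU hl hu zS) ql qu.
    (* With the terminals at 1 and 3, a block number is its own block. *)
    have -> : block 1 3 (q z) = q z.
      have : (q z <= 4)%N by case/setUP: zS => zS; [rewrite q1|rewrite q2]; rewrite // block_le4.
      by rewrite -mem_blocks; case: (q z) => [|[|[|[|[|[]]]]]].
    by case/setUP: zS => zS; [rewrite q1 //; case: f1 => _; apply|rewrite q2 //; case: f2 => _; apply].
  move=> x y xS yS; have [/setDP[xS1 xS2] /setDP[yS2 yS1]] := (xS, yS).
  rewrite -(q1 x) // -(q2 y) //; have := M4 x y xS yS; have := M3 x y; have := M3 y x.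
  rewrite !inE xS1 yS2 !orbT /= => a1 a2 a3.
  split=> qq dd; move: qq; rewrite leq_eqVlt => /predU1P[e|qlt].
  - by move: a3; rewrite dd; apply.
  - exact: a2.
  - by move: a3; rewrite (negbTE dd); apply.
  - exact: a1.
exists F; apply: ext_family_cross.
- by move=> i d i6; have [] := hF i d i6.
- move=> x y xS yS /(r1 x y xS yS)[i [d [i6 lt]]]; exists i, d; split=> //.
  by have [M1 _ _ _] := hF i d i6; rewrite M1.
- move=> x y xS yS /(r2 x y xS yS)[i [d [i6 lt]]]; exists i, d; split=> //.
  by have [_ M2 _ _] := hF i d i6; rewrite M2.
move=> x y xS yS; have [/setDP[xS1 xS2] /setDP[yS2 yS1]] := (xS, yS).
have xt : x \notin [set u; v] by rewrite -S12 inE (negbTE xS2) andbF.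
have yt : y \notin [set u; v] by rewrite -S12 inE (negbTE yS1).
split=> nle.
(* Here [y] lies in a block no higher than that of [x]; with [d] false the second piece comes first
   in a tie, so [y] precedes [x]. *)
- have [i i6 hi] := parallel_slot uv o'P xt yt nle; exists i, false; split=> //.
  have [_ _ _ /(_ x y xS yS)[_ h]] := hF i false i6; apply: h => //.
  have [_ _ [_ f1]] := h1 i false i6; have [_ _ [_ f2]] := h2 i false i6.
  by apply: hi; rewrite ?block_le4 //; [apply: f1|apply: f2].
- have [i i6 hi] := parallel_slot uv o'P yt xt nle; exists i, true; split=> //.
  have [_ _ _ /(_ x y xS yS)[h _]] := hF i true i6; apply: h => //.
  have [_ _ [_ f1]] := h1 i true i6; have [_ _ [_ f2]] := h2 i true i6.
  by apply: hi; rewrite ?block_le4 //; [apply: f2|apply: f1].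
Qed.

(** * A single edge *)

Lemma slot_not_ge u v o i : u != v -> (i < 6)%N ->
  ~~ (upper u v (slot (u <= v) (v <= u) o i) <= lower u v (slot (u <= v) (v <= u) o i)).
Proof.
move=> uv i6; apply/negP; rewrite /upper /lower.
have := @slot_orient (u <= v) (v <= u) o i i6.
case: (boolP (u <= v)) => [h1|/negP h1]; case: (boolP (v <= u)) => [h2|/negP h2].
- by have := eq_le u v; rewrite h1 h2 (negbTE uv).
- by move=> /(_ isT) ->.
- by move=> /(_ isT) ->.
- by case: ifP.
Qed.

Lemma extendable_edge u v : u != v -> extendable u v [set u; v].
Proof.
move=> uv o; set s := slot (u <= v) (v <= u) o.
have lu i : lower u v (s i) != upper u v (s i).
  by rewrite /lower /upper; case: ifP => // _; rewrite eq_sym.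
have ng i : (i < 6)%N -> (upper u v (s i) <= lower u v (s i)) = false.
  by move=> i6; apply/negbTE/slot_not_ge.
have memE i z : (z \in [set u; v]) = (z == lower u v (s i)) || (z == upper u v (s i)).
  by rewrite !inE /lower /upper; case: ifP => // _; rewrite orbC.
exists (fun i _ z => nat_of_bool (z == upper u v (s i))); split=> [i d i6|x y]; last first.
  (* Slots 2 and 3 orient incomparable terminals in opposite ways; comparable ones are oriented as
     in [P]. *)
  move=> /set2P xS /set2P yS nxy; case: xS yS nxy => -> [] -> nxy; rewrite ?lexx // in nxy *.
    exists 3, true; split=> //; rewrite /s /upper /slot /slots (negbTE nxy) /=.
    by case: (v <= u) => /=; rewrite eqxx [v == u]eq_sym (negbTE uv).
  exists 2, true; split=> //; rewrite /s /upper /slot /slots (negbTE nxy) orbF.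
  by case: (u <= v) => /=; rewrite eqxx (negbTE uv).
split.
- move=> x y; rewrite !(memE i) => /orP[] /eqP -> /orP[] /eqP ->; rewrite ?ltxx // ?(negbTE (lu i)) ?eqxx //.
  by move/ltW; rewrite ng.
- move=> x y; rewrite !(memE i) => /orP[] /eqP -> /orP[] /eqP -> //; rewrite ?eqxx (negbTE (lu i)) //.
have fit : (nat_of_bool (lower u v (s i) == upper u v (s i)) < nat_of_bool (upper u v (s i) == upper u v (s i)))%N.
  by rewrite eqxx (negbTE (lu i)).
rewrite -/s; split=> // z; rewrite (memE i) /pos => /orP[] /eqP ->.
  rewrite block_lower //; have := ng i i6; rewrite /fits /trace_of /lower /upper.
  case: (s i) => kd [] /= h; rewrite !lexx h ?andbF ?andbT /= ?implybT /=;
  by case: kd => [||[] []] //=; rewrite ?andbF ?orbT.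
rewrite block_upper //; have := ng i i6; rewrite /fits /trace_of /lower /upper.
case: (s i) => kd [] /= h; rewrite !lexx h ?andbF ?andbT /= ?implybT /=;
by case: kd => [||[] []] //=; rewrite ?andbF ?orbT.
Qed.

(** * Series composition *)

Definition rel_of u v w : rel3 := ((u <= v, v <= u), ((u <= w, w <= u), (v <= w, w <= v))).

(** The second alternative is there because the outer terminals may be related through the rest of
    the poset, outside both pieces. *)
Definition sep_series u v w x y := x <= y -> x <= w <= y \/ [/\ x <= u, u <= v & v <= y].

Lemma series_perm u v w o : u != v -> u != w -> v != w ->
  o \in orients (u <= v) (v <= u) -> exists2 p, p \in perms & series_ok (rel_of u v w) o p.
Proof.
move=> uv uw vw oP; have /allP/(_ (rel_of u v w)) := series_check.
have ne x y : x != y -> ~~ ((x <= y) && (y <= x)) by move=> xy; rewrite -eq_le.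
rewrite mem_rels => h; suff /h/allP/(_ o oP)/hasP[p pP pok] : consistent3 (rel_of u v w) by exists p.
rewrite /consistent3 /rel_of /ab /ba /ac /ca /bc /cb ![fst _]/= ![snd _]/= !ne //=.
by do !(apply/andP; split); apply/implyP => /andP[h1 h2];
  apply: le_trans h1 h2 || apply: le_trans h2 h1.
Qed.

Lemma mem_slot_pairs i d : (i < 6)%N -> (i, d) \in pairs (iota 0 6) bools.
Proof. by move=> i6; apply/allpairsP; exists (i, d); rewrite mem_iota i6; case: d. Qed.

Lemma code_inj (c : seq nat) k k' : size c == 5 -> sorted ltn c -> (k <= 4)%N -> (k' <= 4)%N ->
  nth 0 c k = nth 0 c k' -> k = k'.
Proof.
move=> /eqP sc cs k4 k'4 /eqP; rewrite nth_uniq ?sc ?ltnS //; first by move/eqP.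
by apply: sorted_uniq cs; [apply: ltn_trans|apply: ltnn].
Qed.

Lemma code_mono (c : seq nat) k k' : size c == 5 -> sorted ltn c -> (k' <= 4)%N -> (k <= k')%N ->
  (nth 0 c k <= nth 0 c k')%N.
Proof.
move=> /eqP sc cs k'4; rewrite leq_eqVlt => /predU1P[->//|kk]; apply: ltnW.
by apply: (sorted_ltn_nth ltn_trans) => //; rewrite inE sc ltnS // (leq_trans (ltnW kk)).
Qed.

(** The slots of the pieces are paired by [p] and their blocks interleaved by [weave]. The finite
    check shows that the results fit the slots of the composition and reverse every incomparable
    cross pair. *)
Lemma extendable_series u v w S1 S2 :
  u != v -> u != w -> v != w -> u \in S1 -> v \in S2 -> S1 :&: S2 = [set w] ->
  {in S1 & S2, forall x y, sep_series u v w x y /\ sep_series v u w y x} ->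
  extendable u w S1 -> extendable v w S2 -> extendable u v (S1 :|: S2).
Proof.
move=> uv uw vw uS1 vS2 S12 hsep E1 E2 o.
have [o' o'P eo] := mem_orients (u <= v) (v <= u) o.
apply: extendable_slots eo _.
have [p pP /andP[/allP good /allP cov]] := series_perm uv uw vw o'P.
set r := rel_of u v w in good cov; set qo := child_orients r o' in good cov.
have [F1 [h1 r1]] := E1 qo.1; have [F2 [h2 r2]] := E2 qo.2.
have [wS1 wS2] : w \in S1 /\ w \in S2 by apply/andP; rewrite -in_setI S12 inE.
pose s i := slot (u <= v) (v <= u) o' i.
pose s1 i := slot (u <= w) (w <= u) qo.1 (nth 0 p.1 i).
pose s2 i := slot (v <= w) (w <= v) qo.2 (nth 0 p.2 i).
pose W i d := weave d (s i) (s1 i).2 (s2 i).2.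
pose G1 i d := F1 (nth 0 p.1 i) d; pose G2 i d := F2 (nth 0 p.2 i) d.
pose p1 i d z := nth 0 (W i d).1 (pos u w (s1 i) (G1 i d) z).
pose p2 i d z := nth 0 (W i d).2 (pos v w (s2 i) (G2 i d) z).
pose G i d f :=
  [/\ {in S1 &, forall x y, (f x < f y) = (G1 i d x < G1 i d y)}%N,
      {in S2 &, forall x y, (f x < f y) = (G2 i d x < G2 i d y)}%N,
      [/\ mono_on (S1 :|: S2) f, {in S1 :|: S2 &, injective f} & fitting (S1 :|: S2) u v (s i) f] &
      {in S1 :\: S2 & S2 :\: S1, forall x y,
        ((p1 i d x < p2 i d y)%N -> (f x < f y)%N) /\
        ((p2 i d y < p1 i d x)%N -> (f y < f x)%N)}].
have [F hF] : exists F, forall i d, (i < 6)%N -> G i d (F i d).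
  apply: slots_choice => i d i6; have [j1 j2] := perms_bound pP i6.
  have [m1 i1 f1] := h1 _ d j1; have [m2 i2 f2] := h2 _ d j2.
  have /and4P[/and5P[z1 c1 z2 c2 plu] dis g1 g2] := good _ (mem_slot_pairs d i6).
  rewrite -/(s i) -/(s1 i) -/(s2 i) -/(W i d) in z1 c1 z2 c2 plu dis g1 g2.
  rewrite -/(s1 i) -/(G1 i d) in m1 i1 f1; rewrite -/(s2 i) -/(G2 i d) in m2 i2 f2.
  have P1 (o1 : bool) : pos u w (s1 i) (G1 i d) (if o1 == (s1 i).2 then u else w) = terminal o1.
    have := pos_lower f1; have := pos_upper f1; rewrite /lower /upper.
    by case: (s1 i).2; case: o1.
  have P2 (o2 : bool) : pos v w (s2 i) (G2 i d) (if o2 == (s2 i).2 then v else w) = terminal o2.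
    have := pos_lower f2; have := pos_upper f2; rewrite /lower /upper.
    by case: (s2 i).2; case: o2.
  have T1 z : z \in S1 -> forall o1, pos u w (s1 i) (G1 i d) z = terminal o1 ->
      z = if o1 == (s1 i).2 then u else w.
    move=> zS o1 /(fitting_terminal f1 zS) ->; rewrite /lower /upper.
    by case: (s1 i).2; case: o1.
  have T2 z : z \in S2 -> forall o2, pos v w (s2 i) (G2 i d) z = terminal o2 ->
      z = if o2 == (s2 i).2 then v else w.
    move=> zS o2 /(fitting_terminal f2 zS) ->; rewrite /lower /upper.
    by case: (s2 i).2; case: o2.
  have nb (b : bool) : (~~ b == b) = false by case: b.
  have P1w := P1 (~~ (s1 i).2); have P1u := P1 (s1 i).2; rewrite nb eqxx in P1w P1u.
  have P2w := P2 (~~ (s2 i).2); have P2v := P2 (s2 i).2; rewrite nb eqxx in P2w P2v.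
  (* Positions from different pieces coincide only at [w], so merging leaves no tie between the
     pieces. *)
  have disE x y : (p1 i d x == p2 i d y) =
      (pos u w (s1 i) (G1 i d) x == terminal (~~ (s1 i).2)) &&
      (pos v w (s2 i) (G2 i d) y == terminal (~~ (s2 i).2)).
    have k1 : pos u w (s1 i) (G1 i d) x \in blocks by rewrite mem_blocks block_le4.
    have k2 : pos v w (s2 i) (G2 i d) y \in blocks by rewrite mem_blocks block_le4.
    by have /allP/(_ _ k1)/allP/(_ _ k2)/eqP := dis.
  have inj1 x y : p1 i d x = p1 i d y -> pos u w (s1 i) (G1 i d) x = pos u w (s1 i) (G1 i d) y.
    by apply: code_inj; rewrite ?block_le4.
  have inj2 x y : p2 i d x = p2 i d y -> pos v w (s2 i) (G2 i d) x = pos v w (s2 i) (G2 i d) y.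
    by apply: code_inj; rewrite ?block_le4.
  have w12 : p1 i d w = p2 i d w by apply/eqP; rewrite disE P1w P2w !eqxx.
  have cross x y : x \in S1 -> y \in S2 -> p1 i d x = p2 i d y -> x = w /\ y = w.
    move=> xS yS /eqP; rewrite disE => /andP[/eqP/(T1 x xS) -> /eqP/(T2 y yS) ->].
    by rewrite !nb.
  have [||z|x z xS|x z xS|f] := merge (S1 := S1) (S2 := S2) (f1 := G1 i d) (f2 := G2 i d)
    (p1 := p1 i d) (p2 := p2 i d) true.
  - by move=> x y _ _ xy; apply: code_mono; rewrite ?block_le4 ?leq_block.
  - by move=> x y _ _ xy; apply: code_mono; rewrite ?block_le4 ?leq_block.
  - by rewrite S12 => /set1P ->.
  - by rewrite S12 => /set1P -> /inj1; rewrite P1w => /(T1 x xS); rewrite nb.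
  - by rewrite S12 => /set1P -> /inj2; rewrite P2w => /(T2 x xS); rewrite nb.
  set q := glue _ _ _ => -[M1 M2 M3 _]; exists f.
  have q1 z : z \in S1 -> q z = p1 i d z by rewrite /q /glue => ->.
  have q2 z : z \in S2 -> q z = p2 i d z.
    move=> zS2; rewrite /q /glue; case: ifP => // zS1.
    by have : z \in S1 :&: S2 by [rewrite inE zS1]; rewrite S12 => /set1P ->.
  have uSU : u \in S1 :|: S2 by rewrite inE uS1.
  have vSU : v \in S1 :|: S2 by rewrite inE vS2 orbT.
  have isou : {in S1 :|: S2, forall z, q z = q u -> z = u}.
    move=> z /setUP[zS|zS]; rewrite (q1 u) //.
      by rewrite q1 // => /inj1; rewrite P1u => /(T1 z zS); rewrite eqxx.
    by rewrite q2 // => /esym/cross-/(_ uS1 zS)[e _]; move: uw; rewrite e eqxx.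
  have isov : {in S1 :|: S2, forall z, q z = q v -> z = v}.
    move=> z /setUP[zS|zS]; rewrite (q2 v) //.
      by rewrite q1 // => /cross-/(_ zS vS2)[_ e]; move: vw; rewrite e eqxx.
    by rewrite q2 // => /inj2; rewrite P2v => /(T2 z zS); rewrite eqxx.
  have ql : q (lower u v (s i)) = if (s i).2 then nth 0 (W i d).1 (terminal (s1 i).2)
      else nth 0 (W i d).2 (terminal (s2 i).2).
    by rewrite /lower; case: ifP => _; [rewrite q1 // /p1 P1u|rewrite q2 // /p2 P2v].
  have qu : q (upper u v (s i)) = if (s i).2 then nth 0 (W i d).2 (terminal (s2 i).2)
      else nth 0 (W i d).1 (terminal (s1 i).2).
    by rewrite /upper; case: ifP => _; [rewrite q2 // /p2 P2v|rewrite q1 // /p1 P1u].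
  have lSU : lower u v (s i) \in S1 :|: S2 by rewrite /lower; case: ifP.
  have uuSU : upper u v (s i) \in S1 :|: S2 by rewrite /upper; case: ifP.
  have flu : (f (lower u v (s i)) < f (upper u v (s i)))%N by apply: M3; rewrite // ql qu.
  (* Every slot orients comparable terminals as in [P]; this serves the comparabilities that pass
     through both [u] and [v]. *)
  have fuv x y : (x == u) && (y == v) || (x == v) && (y == u) -> x <= y -> (f x < f y)%N.
    move=> xy le; move: flu; rewrite /lower /upper.
    have := @slot_orient (u <= v) (v <= u) o' i i6; rewrite -/(s i).
    have nle : (u <= v) && (v <= u) = false by rewrite -eq_le (negbTE uv).
    case/orP: xy le nle => /andP[/eqP -> /eqP ->] -> /=; first by move=> -> /(_ isT) ->.
    by rewrite andbT => -> /(_ isT) ->.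
  have M5 x y : x \in S1 :\: S2 -> y \in S2 :\: S1 ->
      [/\ f x <> f y, x < y -> (f x < f y)%N & y < x -> (f y < f x)%N].
    move=> xS yS; have [/setDP[xS1 xS2] /setDP[yS2 yS1]] := (xS, yS).
    have [s12 s21] := hsep x y xS1 yS2.
    have fle S f' z t : mono_on S f' -> z \in S -> t \in S -> z <= t -> (f' z <= f' t)%N.
      by move=> m zS tS; rewrite le_eqVlt => /predU1P[->//|zt]; apply/ltnW/m.
    have fle1 z t : z \in S1 -> t \in S1 -> z <= t -> (f z <= f t)%N.
      by move=> zS tS zt; rewrite leqNgt M1 // -leqNgt (fle _ _ _ _ m1).
    have fle2 z t : z \in S2 -> t \in S2 -> z <= t -> (f z <= f t)%N.
      by move=> zS tS zt; rewrite leqNgt M2 // -leqNgt (fle _ _ _ _ m2).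
    split.
    - have := M3 x y; have := M3 y x; rewrite !inE xS1 yS2 !orbT /=.
      move=> a1 a2 e; move: a1 a2; rewrite e ltnn.
      case: ltngtP => // [_ a|_ _ a|qe _ _]; [by have := a isT isT isT|by have := a isT isT isT|].
      move: qe; rewrite (q1 x) // (q2 y) // => /esym/(cross x y xS1 yS2)[xw _].
      by move: xS2; rewrite xw wS2.
    - move=> /ltW/s12[/andP[xw wy]|[xu le_uv vy]].
        apply: (@ltn_trans (f w)); [rewrite M1 // m1 //|rewrite M2 // m2 //]; rewrite lt_neqAle ?xw ?wy andbT.
          by apply: contraNneq xS2 => ->.
        by apply: contraNneq yS1 => <-.
      apply: leq_ltn_trans (fle1 _ _ xS1 uS1 xu) _; apply: leq_trans (fle2 _ _ vS2 yS2 vy).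
      by apply: fuv; rewrite // !eqxx.
    - move=> /ltW/s21[/andP[yw wx]|[yv le_vu ux]].
        apply: (@ltn_trans (f w)); [rewrite M2 // m2 //|rewrite M1 // m1 //]; rewrite lt_neqAle ?yw ?wx andbT.
          by apply: contraNneq yS1 => ->.
        by apply: contraNneq xS2 => <-.
      apply: leq_ltn_trans (fle2 _ _ yS2 vS2 yv) _; apply: leq_trans (fle1 _ _ uS1 xS1 ux).
      by apply: fuv; rewrite // !eqxx orbT.
  have [mf jf] := ext_setU M1 M2 m1 m2 i1 i2 M5.
  split=> //.
    split=> //; split=> // z zS.
    have hl : {in S1 :|: S2, forall z, q z = q (lower u v (s i)) -> z = lower u v (s i)}.
      by rewrite /lower; case: ifP.
    have hu : {in S1 :|: S2, forall z, q z = q (upper u v (s i)) -> z = upper u v (s i)}.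
      by rewrite /upper; case: ifP.
    rewrite /pos (block_transfer M3 lSU uuSU hl hu zS) ql qu.
    (* As a Boolean equality, the separation yields exactly the formulas of [ext1] and [ext2]. *)
    have sepE u' v' w' x y : sep_series u' v' w' x y ->
        (x <= y) = (x <= w') && (w' <= y) || [&& x <= u', u' <= v' & v' <= y].
      move=> sxy; apply/idP/idP => [/sxy[->|[-> -> ->]]|]; rewrite ?orbT //.
      case/orP => [/andP[xw wy]|/and3P[xu uv' vy]]; first exact: le_trans wy.
      by apply: le_trans xu _; apply: le_trans vy.
    case/setUP: zS => zS.
      rewrite q1 //; have k1 : pos u w (s1 i) (G1 i d) z \in blocks by rewrite mem_blocks block_le4.
      have /allP/(_ _ (trace_of_traces u w z))/allP/(_ _ k1)/implyP := g1.
      have [_ /(_ z zS) fz] := f1; move=> /(_ fz); congr (fits _ _ _); rewrite /ext1 /trace_of.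
      have [sv vs] := hsep z v zS vS2.
      have := sepE _ _ _ _ _ sv; have := sepE _ _ _ _ _ vs.
      by rewrite !lexx /= andbT => -> ->; congr (_, _, _, _); rewrite orbC.
    rewrite q2 //; have k2 : pos v w (s2 i) (G2 i d) z \in blocks by rewrite mem_blocks block_le4.
    have /allP/(_ _ (trace_of_traces v w z))/allP/(_ _ k2)/implyP := g2.
    have [_ /(_ z zS) fz] := f2; move=> /(_ fz); congr (fits _ _ _); rewrite /ext2 /trace_of.
    have [us su] := hsep u z uS1 zS.
    have := sepE _ _ _ _ _ su; have := sepE _ _ _ _ _ us.
    by rewrite !lexx /= andbT => -> ->; congr (_, _, _, _); rewrite orbC.
  move=> x y xS yS; have [/setDP[xS1 xS2] /setDP[yS2 yS1]] := (xS, yS).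
  have := M3 x y; have := M3 y x; rewrite !inE xS1 yS2 !orbT /= (q1 x) // (q2 y) // => a1 a2.
  by split=> [/a2|/a1]; apply.
exists F; apply: ext_family_cross.
- by move=> i d i6; have [] := hF i d i6.
- move=> x y xS yS /(r1 x y xS yS)[i [d [i6 lt]]].
  have [j [_ [j6 _ ej _]]] := perms_onto pP i6; exists j, d; split=> //.
  by have [M1 _ _ _] := hF j d j6; rewrite M1 // /G1 ej.
- move=> x y xS yS /(r2 x y xS yS)[i [d [i6 lt]]].
  have [_ [j [_ j6 _ ej]]] := perms_onto pP i6; exists j, d; split=> //.
  by have [_ M2 _ _] := hF j d j6; rewrite M2 // /G2 ej.
move=> x y xS yS; have [/setDP[xS1 xS2] /setDP[yS2 yS1]] := (xS, yS).
have /allP/(_ _ (trace_of_traces v w y)) := cov _ (trace_of_traces u w x).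
have xw : (x <= w) && (w <= x) = false.
  by rewrite -eq_le; apply: contraNF xS2 => /eqP ->.
have yw : (y <= w) && (w <= y) = false.
  by rewrite -eq_le; apply: contraNF yS1 => /eqP ->.
rewrite /trace_of ![fst _]/= ![snd _]/= xw yw !orFb -/(trace_of u w x) -/(trace_of v w y) => /andP[c12 c21].
have dP i d : (i, d) \in pairs (iota 0 6) bools -> (i < 6)%N.
  by case/allpairsP => -[i' d'] [+ _ [-> _]]; rewrite mem_iota.
split=> nle.
- case/orP: c12 => [|/hasP[[i d] /dP i6 /allP pr]].
    move=> /orP[/andP[h h']|/and3P[h h' h'']]; move: nle;
      by rewrite ?(le_trans h h') // (le_trans h) // (le_trans h').
  exists i, d; split=> //; have [_ _ _ /(_ x y xS yS)[_]] := hF i d i6; apply.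
  have [j1 j2] := perms_bound pP i6.
  have [_ _ [_ f1]] := h1 _ d j1; have [_ _ [_ f2]] := h2 _ d j2.
  have k1 : pos u w (s1 i) (G1 i d) x \in blocks by rewrite mem_blocks block_le4.
  have k2 : pos v w (s2 i) (G2 i d) y \in blocks by rewrite mem_blocks block_le4.
  by have /implyP/(_ (f2 y yS2))/allP/(_ _ k1)/implyP/(_ (f1 x xS1)) := pr _ k2.
- case/orP: c21 => [|/hasP[[i d] /dP i6 /allP pr]].
    move=> /orP[/andP[h h']|/and3P[h h' h'']]; move: nle;
      by rewrite ?(le_trans h h') // (le_trans h) // (le_trans h').
  exists i, d; split=> //; have [_ _ _ /(_ x y xS yS)[+ _]] := hF i d i6; apply.
  have [j1 j2] := perms_bound pP i6.
  have [_ _ [_ f1]] := h1 _ d j1; have [_ _ [_ f2]] := h2 _ d j2.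
  have k1 : pos u w (s1 i) (G1 i d) x \in blocks by rewrite mem_blocks block_le4.
  have k2 : pos v w (s2 i) (G2 i d) y \in blocks by rewrite mem_blocks block_le4.
  by have /implyP/(_ (f1 x xS1))/allP/(_ _ k2)/implyP/(_ (f2 y yS2)) := pr _ k1.
Qed.

(** * Series-parallel pieces *)

(* A piece with vertex set [S], terminals [u] and [v] and edge set [E]. *)
Inductive piece : P -> P -> {set P} -> {set {set P}} -> Prop :=
| PieceEdge u v : u != v -> piece u v [set u; v] [set [set u; v]]
| PieceParallel u v S1 S2 E1 E2 :
    piece u v S1 E1 -> piece u v S2 E2 -> S1 :&: S2 = [set u; v] ->
    {in S1 & S2, forall x y, sep [set u; v] x y /\ sep [set u; v] y x} ->
    piece u v (S1 :|: S2) (E1 :|: E2)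
| PieceSeries u v w S1 S2 E1 E2 :
    u != v -> piece u w S1 E1 -> piece v w S2 E2 -> S1 :&: S2 = [set w] ->
    {in S1 & S2, forall x y, sep_series u v w x y /\ sep_series v u w y x} ->
    piece u v (S1 :|: S2) (E1 :|: E2).

Lemma piece_terminals u v S E : piece u v S E -> [/\ u != v, u \in S & v \in S].
Proof.
elim=> {u v S E} [u v uv|u v S1 S2 E1 E2 _ [uv uS vS] _ _ _ _|u v w S1 S2 E1 E2 uv _ [_ uS _] _ [_ vS _] _ _].
- by rewrite !inE !eqxx orbT.
- by rewrite !inE uS vS.
- by rewrite !inE uS vS orbT.
Qed.

Lemma piece_edges u v S E : piece u v S E ->
  {in E, forall e : {set P}, e \subset S} /\ {in S, forall x, exists2 e, e \in E & x \in e}.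
Proof.
have join S1 S2 (E1 E2 : {set {set P}}) :
    {in E1, forall e : {set P}, e \subset S1} /\ {in S1, forall x, exists2 e, e \in E1 & x \in e} ->
    {in E2, forall e : {set P}, e \subset S2} /\ {in S2, forall x, exists2 e, e \in E2 & x \in e} ->
    {in E1 :|: E2, forall e : {set P}, e \subset S1 :|: S2} /\
    {in S1 :|: S2, forall x, exists2 e, e \in E1 :|: E2 & x \in e}.
  move=> [s1 c1] [s2 c2]; split.
    by move=> e /setUP[/s1|/s2] /subset_trans; apply; rewrite (subsetUl, subsetUr).
  by move=> x /setUP[/c1|/c2] [e eE xe]; exists e; rewrite // inE eE ?orbT.
elim=> {u v S E} [u v uv|u v S1 S2 E1 E2 _ h1 _ h2 _ _|u v w S1 S2 E1 E2 _ _ h1 _ h2 _ _]; try exact: join.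
split; first by move=> e /set1P ->.
by move=> x xS; exists [set u; v] => //; rewrite set11.
Qed.

Lemma piece_extendable u v S E : piece u v S E -> extendable u v S.
Proof.
elim=> {u v S E} [u v|u v S1 S2 E1 E2 p1 h1 _ h2 S12 s|u v w S1 S2 E1 E2 uv p1 h1 p2 h2 S12 s].
- exact: extendable_edge.
- by have [uv _ _] := piece_terminals p1; apply: extendable_parallel s h1 h2.
- have [uw uS _] := piece_terminals p1; have [vw vS _] := piece_terminals p2.
  exact: extendable_series S12 s h1 h2.
Qed.

(** By induction, descend to the piece that contains the edge [e]. A comparability between [c] and
    the other piece passes through an element of [e], to which the separation already known
    applies. *)
Lemma piece_insert u v S E e c :
  piece u v S E -> e \in E -> c \notin S -> {in S, forall y, sep e c y /\ sep e y c} ->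
  exists E', [/\ piece u v (c |: S) E', E \subset E' & {in e, forall x, [set x; c] \in E'}].
Proof.
move=> H; elim: H e => {u v S E} [u v uv|u v S1 S2 E1 E2 p1 h1 p2 h2 S12 s|u v w S1 S2 E1 E2 uv p1 h1 p2 h2 S12 s] e.
- move=> /set1P ->; rewrite !inE negb_or => /andP[cu cv] hc.
  have -> : c |: [set u; v] = [set u; v] :|: ([set u; c] :|: [set v; c]).
    by apply/setP => x; rewrite !inE; do !case: (_ == _).
  (* The edge [uv] is doubled by the path [u c v]. *)
  exists ([set [set u; v]] :|: ([set [set u; c]] :|: [set [set v; c]])); split.
  + apply: (PieceParallel (PieceEdge uv)).
    * apply: (PieceSeries uv (PieceEdge _) (PieceEdge _)); rewrite 1?eq_sym //.
        apply/setP => x; rewrite !inE; have [->|_] := eqVneq x u; first by rewrite (negbTE uv).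
        by case: (x == c); rewrite ?orbT.
      move=> x y /set2P[] -> /set2P[] ->; split=> le; [right|right|left|left|left|left|left|left];
        rewrite ?lexx ?andbT //; by split.
    * apply/setP => x; rewrite !inE; have [->|_] := eqVneq x u; first by rewrite ?orbT.
      by have [->|_] := eqVneq x v; rewrite ?orbT.
    * by move=> x y xS _; split=> le; exists x; rewrite ?lexx ?le.
  + exact: subsetUl.
  + by move=> x /set2P[] ->; rewrite !inE eqxx ?orbT.
- have [e1 c1] := piece_edges p1; have [e2 c2] := piece_edges p2.
  move=> eE; rewrite inE negb_or => /andP[cS1 cS2] hc.
  have hc1 : {in S1, forall y, sep e c y /\ sep e y c} by move=> y yS; apply: hc; rewrite inE yS.
  have hc2 : {in S2, forall y, sep e c y /\ sep e y c} by move=> y yS; apply: hc; rewrite inE yS orbT.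
  case/setUP: eE => eE.
    have [E' [pE' sub new]] := h1 e eE cS1 hc1; exists (E' :|: E2); split.
    + rewrite setUA; apply: (PieceParallel pE' p2).
        apply/setP => x; have /setP/(_ x) := S12; rewrite !inE => <-.
        by have [->|] := eqVneq x c; rewrite //= (negbTE cS2) ?andbF.
      move=> x y /setU1P[->|xS] yS; last exact: s.
      have [a b] := hc2 y yS; split.
        move=> /a[t te /andP[ct ty]]; have [/(_ ty)[z zuv /andP[tz zy]] _] := s t y (subsetP (e1 _ eE) _ te) yS.
        by exists z; rewrite // (le_trans ct tz).
      move=> /b[t te /andP[yt tc]]; have [_ /(_ yt)[z zuv /andP[yz zt]]] := s t y (subsetP (e1 _ eE) _ te) yS.
      by exists z; rewrite // yz (le_trans zt tc).
    + exact: setSU.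
    + by move=> x /new; rewrite inE => ->.
  have [E' [pE' sub new]] := h2 e eE cS2 hc2; exists (E1 :|: E'); split.
  + rewrite setUCA; apply: (PieceParallel p1 pE').
      apply/setP => x; have /setP/(_ x) := S12; rewrite !inE => <-.
      by have [->|] := eqVneq x c; rewrite //= (negbTE cS1) ?andbF.
    move=> x y xS /setU1P[->|yS]; last exact: s.
    have [a b] := hc1 x xS; split.
      move=> /b[t te /andP[xt tc]]; have [/(_ xt)[z zuv /andP[xz zt]] _] := s x t xS (subsetP (e2 _ eE) _ te).
      by exists z; rewrite // xz (le_trans zt tc).
    move=> /a[t te /andP[ct tx]]; have [_ /(_ tx)[z zuv /andP[tz zx]]] := s x t xS (subsetP (e2 _ eE) _ te).
    by exists z; rewrite // (le_trans ct tz).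
  + exact: setUS.
  + by move=> x /new; rewrite inE => ->; rewrite orbT.
- have [e1 c1] := piece_edges p1; have [e2 c2] := piece_edges p2.
  move=> eE; rewrite inE negb_or => /andP[cS1 cS2] hc.
  have hc1 : {in S1, forall y, sep e c y /\ sep e y c} by move=> y yS; apply: hc; rewrite inE yS.
  have hc2 : {in S2, forall y, sep e c y /\ sep e y c} by move=> y yS; apply: hc; rewrite inE yS orbT.
  have left_trans u' v' x t y : x <= t -> t <= y -> sep_series u' v' w t y ->
      x <= w <= y \/ [/\ x <= u', u' <= v' & v' <= y].
    move=> xt ty /(_ ty)[/andP[tw ->]|[tu -> ->]]; first by left; rewrite (le_trans xt tw).
    by right; rewrite (le_trans xt tu).
  have right_trans u' v' x t y : x <= t -> t <= y -> sep_series u' v' w x t ->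
      x <= w <= y \/ [/\ x <= u', u' <= v' & v' <= y].
    move=> xt ty /(_ xt)[/andP[-> wt]|[-> -> vt]]; first by left; rewrite (le_trans wt ty).
    by right; rewrite (le_trans vt ty).
  case/setUP: eE => eE.
    have [E' [pE' sub new]] := h1 e eE cS1 hc1; exists (E' :|: E2); split.
    + rewrite setUA; apply: (PieceSeries uv pE' p2).
        apply/setP => x; have /setP/(_ x) := S12; rewrite !inE => <-.
        by have [->|] := eqVneq x c; rewrite //= (negbTE cS2) ?andbF.
      move=> x y /setU1P[->|xS] yS; last exact: s.
      have [a b] := hc2 y yS; split.
        move=> /a[t te /andP[ct ty]]; have [st _] := s t y (subsetP (e1 _ eE) _ te) yS.
        exact: left_trans ct ty st.
      move=> /b[t te /andP[yt tc]]; have [_ st] := s t y (subsetP (e1 _ eE) _ te) yS.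
      exact: right_trans yt tc st.
    + exact: setSU.
    + by move=> x /new; rewrite inE => ->.
  have [E' [pE' sub new]] := h2 e eE cS2 hc2; exists (E1 :|: E'); split.
  + rewrite setUCA; apply: (PieceSeries uv p1 pE').
      apply/setP => x; have /setP/(_ x) := S12; rewrite !inE => <-.
      by have [->|] := eqVneq x c; rewrite //= (negbTE cS1) ?andbF.
    move=> x y xS /setU1P[->|yS]; last exact: s.
    have [a b] := hc1 x xS; split.
      move=> /b[t te /andP[xt tc]]; have [st _] := s x t xS (subsetP (e2 _ eE) _ te).
      exact: right_trans xt tc st.
    move=> /a[t te /andP[ct tx]]; have [_ st] := s x t xS (subsetP (e2 _ eE) _ te).
    exact: left_trans ct tx st.
  + exact: setUS.
  + by move=> x /new; rewrite inE => ->; rewrite orbT.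
Qed.

(* [C] is a family of cliques of the 2-tree built on [V]. *)
Definition built (V : {set P}) (C : {set {set P}}) : Prop :=
  {in C, forall k : {set P}, k \subset V} /\
  ((#|V| <= 1)%N \/ exists u v E, piece u v V E /\
    {in C, forall k : {set P}, {in k &, forall x y, x != y -> [set x; y] \in E}}).

Lemma set2_eq x y a b : x != y -> x \in [set a; b] -> y \in [set a; b] -> [set x; y] = [set a; b].
Proof.
move=> xy /set2P[] ex /set2P[] ey; move: xy; rewrite ex ey ?eqxx // => _.
exact: setUC.
Qed.

(** A clique of at most two vertices lies in an edge of the piece, and [c] is inserted over that
    edge. *)
Lemma built_add (V k0 k : {set P}) (C : {set {set P}}) c :
  built V C -> k0 \in C -> k \subset k0 -> (#|k| <= 2)%N -> c \notin V ->
  {in V, forall y, sep k c y /\ sep k y c} -> built (c |: V) ((c |: k) |: C).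
Proof.
move=> [CV hV] k0C kk0 k2 cV hc.
have kV : k \subset V := subset_trans kk0 (CV _ k0C).
have sub : {in (c |: k) |: C, forall k : {set P}, k \subset c |: V}.
  by move=> k' /setU1P[->|/CV h]; [apply: setUS|apply: subset_trans h (subsetUr _ _)].
split=> //.
(* With at most one vertex there may be no piece yet; the second vertex creates it as a single
   edge. *)
have [V1|] := leqP #|V| 1.
  have [V0|[a aV]] := set_0Vmem V; first by left; rewrite V0 setU0 cards1.
  have Va : V = [set a] by apply/esym/eqP; rewrite eqEcard sub1set aV cards1.
  have ac : a != c by apply: contraNneq cV => <-.
  right; exists a, c, [set [set a; c]]; rewrite {1}Va setUC; split; first exact: PieceEdge.
  move=> k' k'C x y xk yk xy; rewrite inE; apply/eqP/set2_eq => //.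
    by have := subsetP (sub _ k'C) _ xk; rewrite Va setUC.
  by have := subsetP (sub _ k'C) _ yk; rewrite Va setUC.
case: hV => [V1 /idPn|[u [v [E [pE clq]]]] _]; [by rewrite -leqNgt|right].
have [sE cE] := piece_edges pE.
(* Any edge serves for an empty [k], any edge at [x] for a singleton, and [k] itself otherwise. *)
have [e eE ke] : exists2 e, e \in E & k \subset e.
  have [k0'|[x xk]] := set_0Vmem k.
    have [_ uV _] := piece_terminals pE; have [e eE _] := cE u uV.
    by exists e; rewrite // k0' sub0set.
  have [k1|[y]] := set_0Vmem (k :\ x).
    have [e eE xe] := cE x (subsetP kV _ xk); exists e => //.
    by rewrite -(setD1K xk) k1 setU0 sub1set.
  rewrite !inE => /andP[yx yk]; exists [set x; y].
    by apply: (clq _ k0C); rewrite ?(subsetP kk0) // eq_sym.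
  suff -> : [set x; y] = k by [].
  by apply/eqP; rewrite eqEcard subUset !sub1set xk yk cards2 eq_sym yx.
have hc' : {in V, forall y, sep e c y /\ sep e y c}.
  move=> y /hc[h1 h2]; split=> [/h1|/h2] [w wk]; exists w => //; exact: (subsetP ke).
have [E' [pE' EE' new]] := piece_insert pE eE cV hc'.
exists u, v, E'; split=> // k' /setU1P[->|k'C] x y; last first.
  by move=> xk yk xy; apply: (subsetP EE'); apply: (clq k').
move=> /setU1P[->|xk] /setU1P[->|yk]; rewrite ?eqxx // => xy.
- by rewrite setUC; apply: new; apply: (subsetP ke).
- by apply: new; apply: (subsetP ke).
- by apply: (subsetP EE'); apply: (clq k0) => //; apply: (subsetP kk0).
Qed.

(** The new vertices of the bag enter one at a time, each attached to those already present. While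
    one is missing, these number at most two, since the bag has at most three elements. *)
Lemma built_bag (B V k0 : {set P}) (C : {set {set P}}) :
  built V C -> k0 \in C -> B :&: V \subset k0 -> (#|B| <= 3)%N ->
  {in B :\: V & V, forall c y, sep (B :&: V) c y /\ sep (B :&: V) y c} ->
  exists C', [/\ built (V :|: B) C', C \subset C' & B \in C'].
Proof.
move=> + + + B3; have [n] := ubnP #|B :\: V|; elim: n V C k0 => // n IH V C k0 BVn bV k0C Bk0 hs.
have [BV|[c cBV]] := set_0Vmem (B :\: V).
  have BsV : B \subset V by rewrite -setD_eq0 BV.
  have eV : V :|: B = V by apply/setUidPl.
  exists (B |: C); rewrite eV subsetUr !inE eqxx; split=> //.
  have [CV hV] := bV; split=> [k /setU1P[->//|/CV//]|].
  case: hV => [|[u [v [E [pE clq]]]]]; [by left|right].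
  exists u, v, E; split=> // k /setU1P[->|/clq//] x y xB yB.
  move: Bk0; rewrite (setIidPl BsV) => /subsetP Bk0.
  by apply: (clq _ k0C); apply: Bk0.
have /setDP[cB cV] := cBV.
have A2 : (#|B :&: V| <= 2)%N.
  rewrite -ltnS; apply: leq_trans B3; apply: proper_card; apply/properP; split; first exact: subsetIl.
  by exists c; rewrite // inE (negbTE cV) andbF.
have bcV := built_add bV k0C Bk0 A2 cV (fun y yV => hs c y cBV yV).
have BcV : B :&: (c |: V) = c |: (B :&: V).
  by apply/setP => x; rewrite !inE; have [->|] := eqVneq x c; rewrite ?cB.
have [|||| C' [bC' sC' BC']] := IH (c |: V) _ (c |: (B :&: V)) _ bcV.
- rewrite -ltnS; apply: leq_trans BVn; apply: proper_card; apply/properP; split.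
    by apply: setDS; apply: subsetUr.
  by exists c; rewrite // !inE eqxx.
- by rewrite !inE eqxx.
- by rewrite BcV.
(* Comparabilities with the vertex [c] just added are trivially separated, as [c] now belongs to the
   separator. *)
- move=> d y; rewrite BcV !inE negb_or -andbA => /and3P[dc dV dB] /orP[/eqP->|yV].
    split=> le; [exists c; rewrite ?lexx ?le ?andbT //|exists c; rewrite ?lexx ?le //];
      by rewrite !inE eqxx.
  have dBV : d \in B :\: V by rewrite inE dV.
  by have [h1 h2] := hs d y dBV yV; split=> [/h1|/h2] [w wA]; exists w; rewrite // inE wA orbT.
exists C'; split=> //; last by apply: subset_trans sC'; apply: subsetUr.
suff <- : (c |: V) :|: B = V :|: B by [].
by apply/setP => x; rewrite !inE; have [->|] := eqVneq x c; rewrite ?cB ?orbT.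
Qed.

(** Since the path stays in the interval from [x] to [y], a separator meeting it supplies the
    intermediate element that [sep] asks for. *)
Lemma cover_path x y : x <= y -> exists s,
  [/\ path (@cover_adj _ P) x s, last x s = y & all (fun z => (x <= z) && (z <= y)) (x :: s)].
Proof.
have [n] := ubnP #|[set z | (x <= z) && (z <= y)]|.
elim: n x => // n IH x xn; rewrite le_eqVlt => /predU1P[->|xy].
  by exists [::]; rewrite /= lexx.
have Py : (x < y) && (y <= y) by rewrite xy lexx.
(* Minimising the size of the down-set selects a minimal element of the half-open interval, which
   therefore covers [x]. *)
case: (@arg_minnP _ y (fun z => (x < z) && (z <= y)) (fun z => #|[set t | t <= z]|) Py).
move=> z /andP[xz zy] zmin; have cxz : cover_adj x z.
  apply/orP; right; rewrite /covers xz; apply/existsP => -[t /andP[xt tz]].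
  have := zmin t; rewrite xt (le_trans (ltW tz) zy) => /(_ isT); apply/negP; rewrite -ltnNge.
  apply: proper_card; apply/properP; split.
    by apply/subsetP => a; rewrite !inE => /le_trans; apply; apply: ltW.
  by exists z; rewrite !inE ?lexx // lt_geF.
have [||s [ps ls /allP as_]] := IH z => //.
  rewrite -ltnS; apply: leq_trans xn; apply: proper_card; apply/properP; split.
    by apply/subsetP => a; rewrite !inE => /andP[/(le_trans (ltW xz)) -> ->].
  by exists x; rewrite !inE ?lexx ?(ltW xy) // lt_geF.
exists (z :: s); split=> //=; first by rewrite cxz.
rewrite lexx (ltW xy) (ltW xz) zy; apply/allP => t ts.
by have := as_ t; rewrite inE ts orbT => /(_ isT)/andP[/(le_trans (ltW xz)) -> ->].
Qed.

(** * From a tree-decomposition to a piece *)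

Section Decomposition.
Context (T : sgraph) (Y : T -> {set cover_graph P}) (tdY : tree_decomposition Y).

Definition adj_in (X : {set T}) : rel T := [rel s t | [&& adj s t, s \in X & t \in X]].

Lemma adj_in_sym X : connect_sym (adj_in X).
Proof.
by apply: sym_connect_sym => s t; rewrite /adj_in /= adj_sym [(t \in X) && _]andbC.
Qed.

Lemma connect_invariant (e : rel T) (Q : T -> Prop) s :
  Q s -> (forall t t', connect e s t -> Q t -> e t t' -> Q t') -> forall t, connect e s t -> Q t.
Proof.
move=> Qs step t /connectP[p + ->]; elim/last_ind: p => //= p x IH.
rewrite rcons_path last_rcons => /andP[pp ex]; apply: step (IH pp) ex.
by apply/connectP; exists p.
Qed.

Lemma connect_adj_in_mono (X X' : {set T}) s t :
  X \subset X' -> connect (adj_in X) s t -> connect (adj_in X') s t.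
Proof.
move=> XX; apply: connect_sub => a b /and3P[ab aX bX]; apply: connect1.
by rewrite /adj_in /= ab !(subsetP XX).
Qed.

Lemma connect_adj_in_path (X : {set T}) s t : s \in X -> connect (adj_in X) s t -> exists p : seq T,
  [/\ path (@adj T) s p, last s p = t, uniq (s :: p) & {subset s :: p <= X}].
Proof.
move=> sX /connectP[p0 pp0 ->]; case: (shortenP pp0) => p pp up _; exists p; split=> //.
  by apply: sub_path pp => a b /and3P[].
move=> x; rewrite inE => /predU1P[->//|]; elim: p s {sX pp0 up} pp => //= a p IH s.
by move=> /andP[/and3P[_ _ aX] /IH h]; rewrite inE => /predU1P[->//|/h].
Qed.

(** A simple path inside [C], the edge from [u] to [w] and a simple path outside [C] join into one
    simple path, to which [td_paths] applies. *)
Lemma bags_across (C : {set T}) (u w t t' : T) :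
  u \in C -> w \notin C -> adj u w -> t \in C -> t' \notin C ->
  connect (adj_in C) t u -> connect (adj_in (~: C)) w t' -> Y t :&: Y t' \subset Y u :&: Y w.
Proof.
move=> uC wC uw tC t'C /(connect_adj_in_path tC)[p [pp lp up sp]].
have wC' : w \in ~: C by rewrite inE.
move=> /(connect_adj_in_path wC')[q [pq lq uq sq]].
have path_pq : path (@adj T) t (p ++ w :: q) by rewrite cat_path pp /= lp uw.
have last_pq : last t (p ++ w :: q) = t' by rewrite last_cat.
have uniq_pq : uniq (t :: p ++ w :: q).
  rewrite -cat_cons cat_uniq up uq andbT; apply/hasPn => x /sq; rewrite inE.
  by apply: contra => /sp.
have sub (v : T) := @td_paths _ _ _ tdY t t' v _ path_pq last_pq uniq_pq.
rewrite subsetI !sub //; first by rewrite -cat_cons mem_cat mem_head orbT.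
by rewrite -cat_cons mem_cat -lp mem_last.
Qed.

Definition reached (W : {set T}) : {set P} := \bigcup_(t in W) Y t.

(** Cutting the tree at the edge from [w] to [u] makes [Y u :&: Y w] a separator of the cover graph,
    which every cover path between the two sides must meet. *)
Lemma next_bag_sep (r w u : T) (W : {set T}) :
  {in W, forall t, connect (adj_in W) r t} -> w \in W -> u \notin W -> adj w u ->
  Y u :&: reached W \subset Y w /\
  {in Y u :\: reached W & reached W, forall c y,
     sep (Y u :&: reached W) c y /\ sep (Y u :&: reached W) y c}.
Proof.
move=> conW wW uW wu.
(* [C] is the part of the tree beyond the edge from [w] to [u]. *)
pose C : {set T} := [set t | connect (adj_in (~: W)) u t].
have uC : u \in C by rewrite inE connect0.
have CW t : t \in C -> t \notin W.
  by rewrite inE; move: t; apply: connect_invariant => // t t' _ _ /and3P[_ _]; rewrite inE.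
have wC : w \notin C by apply: contraL wW => /CW.
have inC t : t \in C -> connect (adj_in C) t u.
  rewrite adj_in_sym inE; move: t; apply: connect_invariant => [|t t' ut ht tt']; first exact: connect0.
  apply: connect_trans ht _; apply: connect1; have /and3P[att' _ _] := tt'.
  by rewrite /adj_in /= att' !inE ut (connect_trans ut (connect1 tt')).
have sWC : W \subset ~: C by apply/subsetP => t tW; rewrite inE; apply: contraL tW => /CW.
(* A walk that leaves [C] must enter [W], because a neighbour of [C] outside [W] is in [C]; and [W]
   is connected. *)
have outC t : t \notin C -> connect (adj_in (~: C)) w t.
  have [_ conT _] := td_tree tdY; move: t (conT w t); apply: connect_invariant => [_|t t' _ ht att' t'C].
    exact: connect0.
  have [tC|tC] := boolP (t \in C); last first.
    by apply: connect_trans (ht tC) _; apply: connect1; rewrite /adj_in /= att' !in_setC tC t'C.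
  have t'W : t' \in W.
    apply: contraR t'C => t'W; have := tC; rewrite !inE => /connect_trans; apply; apply: connect1.
    by rewrite /adj_in /= att' !in_setC t'W CW.
  apply: (connect_adj_in_mono sWC); apply: connect_trans (conW _ t'W).
  by rewrite adj_in_sym conW.
have uw : adj u w by rewrite adj_sym.
have across t t' : t \in C -> t' \notin C -> Y t :&: Y t' \subset Y u :&: Y w.
  by move=> tC t'C; apply: bags_across uC wC uw tC t'C (inC _ tC) (outC _ t'C).
(* Follow the path while its edges lie in bags of [C]; the vertex where this stops lies in bags on
   both sides. *)
have chain x s t t' : t \in C -> t' \notin C -> x \in Y t -> path (@cover_adj _ P) x s ->
    last x s \in Y t' -> exists2 z, z \in x :: s & z \in Y u :&: Y w.
  move=> + t'C; elim: s x t => [|x1 s IH] x t tC xt /=.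
    by move=> _ xt'; exists x; rewrite ?mem_head // (subsetP (across t t' tC t'C)) // inE xt.
  move=> /andP[xx1 ps] ls; have [t1] := td_edges tdY (xx1 : @adj (cover_graph P) x x1).
  rewrite subUset !sub1set => /andP[xt1 x1t1].
  have [t1C|t1C] := boolP (t1 \in C).
    by have [z zs zY] := IH x1 t1 t1C x1t1 ps ls; exists z; rewrite // inE zs orbT.
  by exists x; rewrite ?mem_head // (subsetP (across t t1 tC t1C)) // inE xt.
have subw : Y w \subset reached W by apply: (bigcup_sup w).
have AE z : z \in Y u :&: Y w -> z \in Y u :&: reached W.
  by rewrite !inE => /andP[-> /(subsetP subw)].
split.
  apply/subsetP => z /setIP[zu /bigcupP[t' t'W zt']].
  have t'C : t' \notin C by have := subsetP sWC _ t'W; rewrite in_setC.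
  have /subsetP/(_ z) := across u t' uC t'C.
  by rewrite inE zu zt' => /(_ isT)/setIP[].
move=> c y /setDP[cu _] /bigcupP[t' t'W yt'].
have t'C : t' \notin C by have := subsetP sWC _ t'W; rewrite in_setC.
split=> [/cover_path|/cover_path] [s [ps ls /allP as_]].
  have [|z zs zY] := chain c s u t' uC t'C cu ps; first by rewrite ls.
  by exists z; [apply: AE|apply: as_].
have ps' : path (@cover_adj _ P) c (rev (belast y s)).
  rewrite -ls rev_path; apply: sub_path ps => a b; by rewrite cover_adj_sym.
have ls' : last c (rev (belast y s)) = y.
  by case: (s) ls => [|b s'] //= <-; rewrite ?rev_cons ?last_rcons.
have [|z zs zY] := chain c _ u t' uC t'C cu ps'; first by rewrite ls'.
exists z; [exact: AE|apply: as_].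
by move: zs; rewrite -ls -rev_rcons -lastI mem_rev.
Qed.

Lemma reached_built n (W : {set T}) r C : (#|~: W| <= n)%N -> r \in W ->
  {in W, forall t, connect (adj_in W) r t} -> (forall t, #|Y t| <= 3)%N ->
  built (reached W) C -> {in W, forall t, Y t \in C} -> exists C', built [set: P] C'.
Proof.
move=> + rW + Y3; elim: n W C rW => [|n IH] W C rW Wn conW bW CW.
  have WT : W = setT.
    by move: Wn; rewrite leqn0 cards_eq0 => /eqP W0; rewrite -[W]setCK W0 setC0.
  exists C.
  suff <- : reached W = [set: P] by [].
  by rewrite -(td_vertices tdY) /reached WT; apply: eq_bigl => t; rewrite inE.
have [W0|[t tW]] := set_0Vmem (~: W); first by apply: IH rW _ conW bW CW; rewrite W0 cards0.
(* Connectedness of the tree gives an edge leaving [W], whose far end is the next node to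
   process. *)
have [w [u [wW uW wu]]] : exists w u : T, [/\ w \in W, u \notin W & adj w u].
  have [_ conT _] := td_tree tdY; apply: contrapT => no; move: tW; rewrite inE => /negP; apply.
  move: t (conT r t); apply: connect_invariant => // a b _ aW ab.
  by apply: contrapT => /negP bW'; apply: no; exists a, b.
have [sub hsep] := next_bag_sep conW wW uW wu.
have [C' [bC' sC' uC']] := built_bag bW (CW w wW) sub (Y3 u) hsep.
apply: (IH (u |: W) C').
- by rewrite !inE rW orbT.
- rewrite -ltnS; apply: leq_trans Wn; apply: proper_card; apply/properP; split.
    by rewrite setCS; apply: subsetUr.
  by exists u; rewrite !inE ?eqxx.
- have sWu : W \subset u |: W by apply: subsetUr.
  move=> t' /setU1P[->|/conW/(connect_adj_in_mono sWu)//].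
  apply: connect_trans (connect_adj_in_mono sWu (conW w wW)) _; apply: connect1.
  by rewrite /adj_in /= wu !inE wW eqxx orbT.
- suff -> : reached (u |: W) = reached W :|: Y u by [].
  by rewrite /reached bigcup_setU big_set1; apply: setUC.
- by move=> t' /setU1P[->//|/CW]; apply: (subsetP sC').
Qed.

Lemma decomposition_built : (forall t, #|Y t| <= 3)%N -> exists C, built [set: P] C.
Proof.
move=> Y3; have [/card_gt0P[r _] _ _] := td_tree tdY.
(* Starting from the empty vertex set with the empty clique lets the root bag be added like any
   other. *)
have b0 : built (set0 : {set P}) [set set0].
  by split; [move=> k /set1P ->|left; rewrite cards0].
have [|||C [bC _ rC]] := built_bag (B := Y r) (k0 := set0) b0 _ _ (Y3 r).
- by rewrite inE.
- by rewrite setI0.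
- by move=> c y _; rewrite inE.
apply: (reached_built (W := [set r]) (r := r) (C := C) (leqnn _)) => //; rewrite ?inE //.
- by move=> t /set1P ->; apply: connect0.
- by rewrite /reached big_set1; rewrite set0U in bC.
- by move=> t /set1P ->.
Qed.

End Decomposition.

(** * Realizers with twelve linear orders *)

Lemma realizer_of_nat (F : 'I_12 -> P -> nat) :
  (forall i, mono_on setT (F i)) -> (forall i, injective (F i)) ->
  (forall x y, ~~ (x <= y) -> exists i, (F i y < F i x)%N) ->
  realizer (fun i x y => (F i x <= F i y)%N).
Proof.
move=> mF iF rF; split=> [i|x y].
  split; first by move=> x; apply: leqnn.
  - by move=> x y; rewrite -eqn_leq => /eqP/iF.
  - by move=> x y z; apply: leq_trans.
  - by move=> x y; apply: leq_total.
split=> [|h].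
  by rewrite le_eqVlt => /predU1P[->//|xy] i; apply/ltnW/mF; rewrite ?inE.
by apply: contraT => /rF[i]; rewrite ltnNge h.
Qed.

Lemma extendable_dimension u v : extendable u v [set: P] -> (dimension P <= 12)%N.
Proof.
move=> /(_ (true, true, true))[F [hF rF]].
have i6 (i : 'I_12) : (i./2 < 6)%N by case: i => i /= ?; rewrite ltn_half_double.
apply: (dimension_le (realizer_of_nat (F := fun i => F i./2 (odd i)) _ _ _)).
- by move=> i; have [] := hF i./2 (odd i) (i6 i).
- by move=> i x y; have [_ h _] := hF i./2 (odd i) (i6 i); apply: h; rewrite inE.
move=> x y /rF[]; rewrite ?inE // => i [d [i_6 lt]].
(* The six slots with two choices of [d] give twelve orders, numbered so that [i] is the half and
   [d] the parity. *)
have id12 : (d + i.*2 < 12)%N by lia.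
by exists (Ordinal id12); rewrite /= half_bit_double oddD odd_double addbF oddb.
Qed.

Lemma dimension_small : (#|P| <= 1)%N -> (dimension P <= 12)%N.
Proof.
move=> /card_le1_eqP P1.
apply: (dimension_le (realizer_of_nat (F := fun _ _ => 0%N) _ _ _)).
- by move=> _ x y _ _; rewrite (P1 x y) ?ltxx.
- by move=> _ x y _; apply: P1.
- by move=> x y; rewrite (P1 x y) ?lexx.
Qed.

End Extensions.

Unset Implicit Arguments.

Theorem theorem1 (disp : Order.disp_t) (P : finPOrderType disp)
  (hP : (treewidth (cover_graph P) <= 2)%R) : (dimension P <= 12)%N.
Proof.
have [T [Y [tdY wY]]] := treewidth_attained (cover_graph P).
have Y3 t : #|Y t| <= 3.
  have : (#|Y t|%:Z - 1 <= width Y)%R by rewrite /width; apply: le_bigmax.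
  by move: hP; rewrite -wY; lia.
(* A piece has two distinct terminals, so posets with at most one element are treated apart. *)
have [C [_ [P1|[u [v [E [pE _]]]]]]] := decomposition_built tdY Y3.
  by apply: dimension_small; rewrite -cardsT.
exact: extendable_dimension (piece_extendable pE).
Qed.
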